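(* Let $n_3 = 5\cdot 2^{3}-2 = 38$ and let $\widetilde{\zeta}\in [P_{n_3}^{\otimes 4}]^{*}$ be the sum $$\begin{array}{ll} \widetilde{\zeta}&=x_1^{(11)}x_2^{(11)}x_3^{(11)}x_4^{(5)}+x_1^{(11)}x_2^{(11)}x_3^{(13)}x_4^{(3)}+x_1^{(7)}x_2^{(11)}x_3^{(17)}x_4^{(3)}+x_1^{(11)}x_2^{(7)}x_3^{(17)}x_4^{(3)}+x_1^{(7)}x_2^{(13)}x_3^{(15)}x_4^{(3)}\\ &\quad+x_1^{(11)}x_2^{(15)}x_3^{(9)}x_4^{(3)}+x_1^{(15)}x_2^{(11)}x_3^{(9)}x_4^{(3)}+x_1^{(7)}x_2^{(19)}x_3^{(9)}x_4^{(3)}+x_1^{(19)}x_2^{(7)}x_3^{(9)}x_4^{(3)}+x_1^{(7)}x_2^{(19)}x_3^{(7)}x_4^{(5)}\\ &\quad+x_1^{(19)}x_2^{(7)}x_3^{(7)}x_4^{(5)}+x_1^{(11)}x_2^{(19)}x_3^{(5)}x_4^{(3)}+x_1^{(19)}x_2^{(11)}x_3^{(5)}x_4^{(3)}+x_1^{(11)}x_2^{(21)}x_3^{(3)}x_4^{(3)}+x_1^{(19)}x_2^{(13)}x_3^{(3)}x_4^{(3)}\\ &\quad+x_1^{(7)}x_2^{(23)}x_3^{(5)}x_4^{(3)}+x_1^{(23)}x_2^{(7)}x_3^{(5)}x_4^{(3)}+x_1^{(11)}x_2^{(11)}x_3^{(7)}x_4^{(9)}+x_1^{(11)}x_2^{(7)}x_3^{(11)}x_4^{(9)}+x_1^{(7)}x_2^{(11)}x_3^{(11)}x_4^{(9)}\\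 &\quad+x_1^{(7)}x_2^{(25)}x_3^{(3)}x_4^{(3)}+x_1^{(23)}x_2^{(9)}x_3^{(3)}x_4^{(3)}+x_1^{(15)}x_2^{(17)}x_3^{(3)}x_4^{(3)}+x_1^{(15)}x_2^{(15)}x_3^{(3)}x_4^{(5)}+x_1^{(27)}x_2^{(5)}x_3^{(3)}x_4^{(3)}\\ &\quad+x_1^{(29)}x_2^{(3)}x_3^{(3)}x_4^{(3)}+x_1^{(13)}x_2^{(11)}x_3^{(7)}x_4^{(7)}+x_1^{(11)}x_2^{(7)}x_3^{(13)}x_4^{(7)}+x_1^{(7)}x_2^{(13)}x_3^{(11)}x_4^{(7)}+x_1^{(13)}x_2^{(7)}x_3^{(7)}x_4^{(11)}\\ &\quad+x_1^{(7)}x_2^{(7)}x_3^{(13)}x_4^{(11)}+x_1^{(7)}x_2^{(13)}x_3^{(7)}x_4^{(11)}+x_1^{(11)}x_2^{(7)}x_3^{(7)}x_4^{(13)}+x_1^{(7)}x_2^{(11)}x_3^{(7)}x_4^{(13)}+x_1^{(7)}x_2^{(7)}x_3^{(11)}x_4^{(13)}\\ &\quad+x_1^{(7)}x_2^{(7)}x_3^{(7)}x_4^{(17)}+x_1^{(7)}x_2^{(7)}x_3^{(9)}x_4^{(15)}+x_1^{(7)}x_2^{(11)}x_3^{(5)}x_4^{(15)}+x_1^{(7)}x_2^{(13)}x_3^{(3)}x_4^{(15)}+x_1^{(7)}x_2^{(7)}x_3^{(19)}x_4^{(5)}\\ &\quad+x_1^{(7)}x_2^{(7)}x_3^{(21)}x_4^{(3)}+x_1^{(11)}x_2^{(7)}x_3^{(15)}x_4^{(5)}+x_1^{(11)}x_2^{(15)}x_3^{(7)}x_4^{(5)}+x_1^{(15)}x_2^{(11)}x_3^{(7)}x_4^{(5)}.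 \end{array}$$ The space of $GL_4$-coinvariants $\mathbb Z/2 \otimes_{GL_4} {\rm Ann}_{\overline{\mathcal A}}[P_{n_3}^{\otimes 4}]^{*}$ has dimension $2$ with the basis $\{[x_1^{(0)}x_2^{(0)}x_3^{(7)}x_4^{(31)}], [\widetilde{\zeta}]\}$.
   Context: $\mathcal A$ is the mod 2 Steenrod algebra and $\overline{\mathcal A}$ its set of positive-degree elements. For $h\ge 1$, $P^{\otimes h}=\mathbb Z/2[t_1,\ldots,t_h]$ with $\deg t_i=1$, regarded as the unstable $\mathcal A$-algebra $H^*((\mathbb RP^\infty)^{h};\mathbb Z/2)$; $P^{\otimes h}_n$ is its degree $n$ part. $GL_h=GL_h(\mathbb Z/2)$ acts on $P^{\otimes h}$ by linear substitutions of variables, commuting with $\mathcal A$. The linear dual $[P^{\otimes h}_n]^{*}=H_n((\mathbb RP^\infty)^h;\mathbb Z/2)$ carries the dual $GL_h$-action and the dual right action of $\mathcal A$; $x_1^{(a_1)}\cdots x_h^{(a_h)}$ denotes the basis element dual to the monomial $t_1^{a_1}\cdots t_h^{a_h}$ (so $[P^{\otimes h}]^*$ is the divided power algebra $\Gamma(x_1^{(1)},\ldots,x_h^{(1)})$). ${\rm Ann}_{\overline{\mathcal A}}[P_n^{\otimes h}]^{*}$ is the subspace of elements of $[P^{\otimes h}_n]^{*}$ annihilated by all positive-degree Steenrod operations; it is a $GL_h$-submodule, and $\mathbb Z/2\otimes_{GL_h}{\rm Ann}_{\overline{\mathcal A}}[P_n^{\otimes h}]^{*}$ is its space of $GL_h$-coinvariants.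 For $\zeta\in {\rm Ann}_{\overline{\mathcal A}}[P_n^{\otimes h}]^{*}$, $[\zeta]$ is its image in the coinvariants. *)

(* Defs.v *)
From HB Require Import structures.
From mathcomp Require Import all_boot all_order all_algebra all_fingroup all_field.
From mathcomp Require Import generic_quotient.
From mathcomp.multinomials Require Import mpoly.
From mathcomp Require Import boolp.

Set Implicit Arguments.
Unset Strict Implicit.
Unset Printing Implicit Defensive.

Import GRing.Theory VectorInternalTheory.
Local Open Scope ring_scope.
Local Open Scope quotient_scope.

(* The quotient V / W of a vector space by a subspace, as a vectType. *)
Section QuotientSpace.
Variables (K : fieldType) (V : vectType K) (W : {vspace V}).

Definition quot_rel (x y : V) := x - y \in W.

Lemma quot_rel_equiv : equiv_class_of quot_rel.
Proof.
split=> [x|x y|y x z]; rewrite /quot_rel ?subrr ?mem0v //.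
  by rewrite -opprB memvN.
by move=> xy yz; rewrite -[x](addrNK y) -addrA memvD.
Qed.

Canonical quot_equiv := EquivRelPack quot_rel_equiv.
Canonical quot_encModRel := defaultEncModRel quot_rel.

Definition quotv := {eq_quot quot_rel}.

HB.instance Definition _ : EqQuotient V quot_rel quotv := EqQuotient.on quotv.
HB.instance Definition _ := Choice.on quotv.

Definition quot_pi (v : V) : quotv := \pi v.

Lemma quot_piP x y : reflect (quot_pi x = quot_pi y) (x - y \in W).
Proof. by apply: (iffP idP) => [xy|/eqP]; [apply/eqP|]; rewrite /quot_pi piE. Qed.

Lemma quot_piK q : quot_pi (repr q) = q. Proof. exact: reprK. Qed.

Lemma quot_reprP x : x - repr (quot_pi x) \in W.
Proof. by apply/quot_piP; rewrite quot_piK. Qed.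

Definition quot_add (p q : quotv) : quotv := quot_pi (repr p + repr q).
Definition quot_opp (p : quotv) : quotv := quot_pi (- repr p).
Definition quot_scale (a : K) (p : quotv) : quotv := quot_pi (a *: repr p).

Lemma quot_piD x y : quot_add (quot_pi x) (quot_pi y) = quot_pi (x + y).
Proof.
apply/esym/quot_piP; rewrite opprD addrACA.
by rewrite memvD ?quot_reprP.
Qed.

Lemma quot_piN x : quot_opp (quot_pi x) = quot_pi (- x).
Proof. by apply/esym/quot_piP; rewrite -opprD memvN quot_reprP. Qed.

Lemma quot_piZ a x : quot_scale a (quot_pi x) = quot_pi (a *: x).
Proof. by apply/esym/quot_piP; rewrite -scalerBr memvZ ?quot_reprP. Qed.

Lemma quot_addA : associative quot_add.
Proof.
move=> x y z; rewrite -[x]quot_piK -[y]quot_piK -[z]quot_piK.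
by rewrite !quot_piD addrA.
Qed.

Lemma quot_addC : commutative quot_add.
Proof. by move=> x y; rewrite /quot_add addrC. Qed.

Lemma quot_add0 : left_id (quot_pi 0) quot_add.
Proof. by move=> x; rewrite -[x]quot_piK quot_piD add0r. Qed.

Lemma quot_addN : left_inverse (quot_pi 0) quot_opp quot_add.
Proof. by move=> x; rewrite -[x]quot_piK quot_piN quot_piD addNr. Qed.

HB.instance Definition _ :=
  GRing.isZmodule.Build quotv quot_addA quot_addC quot_add0 quot_addN.

Lemma quot_scaleA a b (x : quotv) :
  quot_scale a (quot_scale b x) = quot_scale (a * b) x.
Proof. by rewrite -[x]quot_piK !quot_piZ scalerA. Qed.

Lemma quot_scale1 : left_id 1 quot_scale.
Proof. by move=> x; rewrite -[x]quot_piK quot_piZ scale1r. Qed.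

Lemma quot_scaleDr : right_distributive quot_scale (+%R : quotv -> _ -> _).
Proof.
move=> a x y; rewrite -[x]quot_piK -[y]quot_piK.
by rewrite [_ + _]quot_piD !quot_piZ [RHS]quot_piD scalerDr.
Qed.

Lemma quot_scaleDl (x : quotv) : {morph quot_scale^~ x : a b / a + b}.
Proof.
move=> a b; rewrite -[x]quot_piK !quot_piZ.
by rewrite [RHS]quot_piD scalerDl.
Qed.

HB.instance Definition _ := GRing.Zmodule_isLmodule.Build K quotv
  quot_scaleA quot_scale1 quot_scaleDr quot_scaleDl.

Lemma quot_pi_is_linear : linear quot_pi.
Proof.
by move=> a x y; apply/esym; rewrite [a *: _]quot_piZ [LHS]quot_piD.
Qed.

HB.instance Definition _ :=
  GRing.isLinear.Build K V quotv _ quot_pi quot_pi_is_linear.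

Lemma quot_vect_iso : Vector.axiom (dim (subvs_of W^C)) quotv.
Proof.
have cW : (W^C :&: W = 0)%VS by rewrite capvC capv_compl.
pose p := daddv_pi W^C W.
have pD v : v - p v \in W.
  have vT : v \in (W^C + W)%VS by rewrite addvC addv_complf memvf.
  by rewrite -{1}(daddv_pi_add cW vT) addrAC subrr add0r memv_pi.
have p0 w : w \in W -> p w = 0.
  move=> wW; have wT : w \in (W^C + W)%VS by rewrite addvC addv_complf memvf.
  apply: (@addIr _ w); rewrite add0r -[RHS](daddv_pi_add cW wT).
  by congr (_ + _); rewrite daddv_pi_id // capv_compl.
pose f0 (v : V) := v2r (vsproj W^C (p v)).
have f0P a x y : f0 (a *: x + y) = a *: f0 x + f0 y by rewrite /f0 !linearP.
pose f (q : quotv) := f0 (repr q).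
have fpi v : f (quot_pi v) = f0 v.
  rewrite /f -[v in RHS](subrK (repr (quot_pi v))) -[X in f0 (X + _)]scale1r.
  by rewrite f0P {2}/f0 p0 ?quot_reprP // !linear0 add0r.
exists f.
  move=> a x y; rewrite -[x]quot_piK -[y]quot_piK.
  by rewrite -quot_pi_is_linear !fpi f0P.
exists (fun r => quot_pi (vsval (r2v r : subvs_of W^C))).
  move=> q; rewrite /f /f0 v2rK vsprojK ?memv_pi // -[RHS]quot_piK.
  by apply/esym/quot_piP; exact: pD.
move=> r; rewrite fpi /f0 daddv_pi_id ?subvsP //.
by rewrite vsvalK r2vK.
Qed.

HB.instance Definition _ := Lmodule_hasFinDim.Build K quotv quot_vect_iso.

End QuotientSpace.

Section SteenrodAction.
Variable h : nat.

(* The number of variables is h.-1.+1, that is h for h >= 1, as in {'GL_h[R]}. *)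
Notation P := {mpoly 'F_2[h.-1.+1]}.
Notation "P_[ n ]" := (dhomog h.-1.+1 'F_2 n).

(* Sq^k f is the coefficient of 'X^k in Sq_total f: the Cartan formula makes
   Sq_total a ring morphism, and instability gives Sq^0 t = t, Sq^1 t = t ^ 2
   and Sq^k t = 0 for k > 1 on each variable t, of degree 1. *)
Definition Sq_total : P -> {poly P} :=
  mmap (polyC \o @mpolyC h.-1.+1 'F_2)
       (fun i => ('X_i)%:P + ('X_i ^+ 2)%:P * 'X).

HB.instance Definition _ := GRing.RMorphism.on Sq_total.

Definition Sq (k : nat) (f : P) : P := (Sq_total f)`_k.

Definition Sq_seq (w : seq nat) (f : P) : P := foldr Sq f w.

(* Every element of the Steenrod algebra is a sum of words
   Sq^(k_1) ... Sq^(k_r), here a seq (seq nat) of exponents, and it acts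
   through any such expression; the Adem relations and Sq^0 = 1 hold on P, so
   that quantifying over expressions or over classes is the same. *)
Definition steenrod_act (theta : seq (seq nat)) (f : P) : P :=
  \sum_(w <- theta) Sq_seq w f.

(* A sum of words each of positive degree: an element of the augmentation
   ideal. *)
Definition steenrod_pos (theta : seq (seq nat)) : bool :=
  all (fun w => 0 < sumn w)%N theta.

Definition homcomp n (f : P) : P_[n] := DHomog (pihomogP mdeg n f).

Notation dual n := 'Hom(P_[n], ('F_2)^o).

(* The right action is (z . theta) f = z (theta f), where z : dual n is
   extended by 0 to the components of degree other than n. *)
Definition annihilated n (z : dual n) : Prop :=
  forall theta f, steenrod_pos theta -> z (homcomp n (steenrod_act theta f)) = 0.

(* The vectors z satisfying [annihilated] form a subspace (AnnP); a sum over
   the finite set of all vectors turns it into a {vspace _}. *)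
Definition Ann n : {vspace dual n} :=
  (\sum_(z : finvect_type (dual n) | `[< annihilated z >]) <[z]>)%VS.

Lemma AnnP n (z : dual n) : reflect (annihilated z) (z \in Ann n).
Proof.
apply: (iffP idP) => [zA|zA]; last first.
  have zP : `[< annihilated (z : finvect_type (dual n)) >] by exact/asboolP.
  by rewrite memvE /Ann (bigD1 (z : finvect_type (dual n)) zP) /= addvSl.
move=> theta f theta_pos.
case/memv_sumP: zA => zs zsP ->; rewrite sum_lfunE big1 // => i iP.
have iA := asboolW iP.
have /vlineP[a ->] : zs i \in <[i : dual n]>%VS by exact: zsP.
by rewrite scale_lfunE iA ?scaler0.
Qed.

(* t_j is sent to \sum_i g i j t_i, a left action of GL_h on P. *)
Definition linsubst_var (g : {'GL_h['F_2]}) : h.-1.+1.-tuple P :=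
  [tuple \sum_i GLval g i j *: 'X_i | j < h.-1.+1].

Definition linsubst g (f : P) : P := f \mPo linsubst_var g.

HB.instance Definition _ g :=
  GRing.Linear.copy (linsubst g) (comp_mpoly (linsubst_var g)).
HB.instance Definition _ g :=
  GRing.RMorphism.copy (linsubst g) (comp_mpoly (linsubst_var g)).

Lemma linsubstX_homog g (m : 'X_{1..h.-1.+1}) :
  linsubst g 'X_[m] \is (mdeg m).-homog.
Proof.
rewrite /linsubst comp_mpolyX mdegE.
elim/big_rec2: _ => [|i d p _ dp]; first exact: dhomog1.
apply: dhomogM => //; rewrite tnth_mktuple -[X in X.-homog]mul1n.
apply: dhomogMn; apply: rpred_sum => j _.
by rewrite rpredZ // dhomogX; apply/eqP; exact: mdeg1.
Qed.

Lemma linsubst_pihomog g n f :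
  linsubst g (pihomog mdeg n f) = pihomog mdeg n (linsubst g f).
Proof.
rewrite [f in LHS]mpolyE [f in RHS]mpolyE (linear_sum (pihomog mdeg n)).
rewrite !(linear_sum (linsubst g)) (linear_sum (pihomog mdeg n)) /=.
apply: eq_bigr => m _; rewrite !linearZ /= pihomogX; congr (_ *: _).
have hm := linsubstX_homog g m; case: eqP => [<-|/eqP ne].
  by rewrite pihomog_dE.
by rewrite linear0 (pihomog_ne0 ne).
Qed.

Lemma linsubst_homog g n f : f \is n.-homog -> linsubst g f \is n.-homog.
Proof. by rewrite !homog_piE -linsubst_pihomog => /eqP->. Qed.

Definition linsubst_deg n g (f : P_[n]) : P_[n] :=
  DHomog (linsubst_homog g (dhomog_is_dhomog f)).

Lemma linsubst_deg_is_linear n g : linear (@linsubst_deg n g).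
Proof. by move=> a x y; apply: val_inj; rewrite /= linearP. Qed.

HB.instance Definition _ n g :=
  GRing.isLinear.Build 'F_2 P_[n] P_[n] _ (@linsubst_deg n g)
    (@linsubst_deg_is_linear n g).

Definition dual_act n (g : {'GL_h['F_2]}) (z : dual n) : dual n :=
  (z \o linfun (@linsubst_deg n g^-1%g))%VF.

Lemma linsubst_Sq_total g f :
  Sq_total (linsubst g f) = map_poly (linsubst g) (Sq_total f).
Proof.
have SqX i : Sq_total 'X_i = ('X_i)%:P + ('X_i ^+ 2)%:P * 'X.
  by rewrite /Sq_total mmapX mmap1U.
have sqrD : {morph (fun p : P => p ^+ 2) : p q / p + q}.
  have ch : 2 \in [pchar P] by rewrite pchar_lalg pchar_Fp.
  by move=> p q /=; rewrite -(pFrobenius_autD_comm ch) // /GRing.comm mulrC.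
rewrite [f in LHS]mpolyE (raddf_sum (linsubst g)) [LHS](raddf_sum Sq_total).
rewrite [f in RHS]mpolyE [in RHS](raddf_sum Sq_total).
rewrite [RHS](raddf_sum (map_poly (linsubst g))); apply: eq_bigr => m _ /=.
have linM p q : linsubst g (p * q) = linsubst g p * linsubst g q.
  exact: rmorphM.
have SqM p q : Sq_total (p * q) = Sq_total p * Sq_total q by exact: rmorphM.
have linC c : linsubst g c%:MP = c%:MP by exact: comp_mpolyC.
have SqC c : Sq_total c%:MP = (c%:MP)%:P by exact: mmapC.
rewrite -mul_mpolyC linM !SqM /=.
rewrite [RHS](rmorphM (map_poly (linsubst g))); congr (_ * _).
  by rewrite linC SqC /= map_polyC /= linC.
rewrite mpolyXE_id (rmorph_prod (linsubst g)) !(rmorph_prod Sq_total).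
rewrite [RHS](rmorph_prod (map_poly (linsubst g))); apply: eq_bigr => i _.
rewrite (rmorphXn (linsubst g)) !(rmorphXn Sq_total).
rewrite [RHS](rmorphXn (map_poly (linsubst g))); congr (_ ^+ _).
rewrite /= SqX (rmorphD (map_poly (linsubst g))) (rmorphM (map_poly (linsubst g))).
rewrite /= map_polyX !map_polyC /= (rmorphXn (linsubst g)).
have linX : linsubst g 'X_i = \sum_j g j i *: 'X_j.
  by rewrite /linsubst comp_mpolyXU -tnth_nth tnth_mktuple.
have sqr_linX : linsubst g 'X_i ^+ 2 = \sum_j g j i *: 'X_j ^+ 2.
  rewrite linX (big_morph _ sqrD (expr0n _ _)); apply: eq_bigr => j _.
  by rewrite exprZn; have := expf_card (g j i); rewrite card_Fp // => ->.
rewrite sqr_linX linX (raddf_sum Sq_total) !(raddf_sum polyC) mulr_suml.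
rewrite -big_split; apply: eq_bigr => j _ /=.
rewrite -!mul_mpolyC SqM SqC SqX !polyCM mulrDr.
by rewrite !mulrA.
Qed.

Lemma linsubst_Sq g k f : linsubst g (Sq k f) = Sq k (linsubst g f).
Proof. by rewrite /Sq linsubst_Sq_total coef_map. Qed.

Lemma linsubst_steenrod_act g theta f :
  linsubst g (steenrod_act theta f) = steenrod_act theta (linsubst g f).
Proof.
rewrite /steenrod_act (raddf_sum (linsubst g)) /=; apply: eq_bigr => w _.
elim: w => //= k w IHw; rewrite -IHw; exact: linsubst_Sq.
Qed.

Lemma Ann_stable n g (z : dual n) : z \in Ann n -> dual_act g z \in Ann n.
Proof.
move=> /AnnP zA; apply/AnnP => theta f theta_pos.
rewrite /dual_act comp_lfunE lfunE /=.
rewrite -(zA theta (linsubst g^-1%g f) theta_pos); congr (z _).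
apply: val_inj => /=.
by rewrite linsubst_pihomog linsubst_steenrod_act.
Qed.

Definition Ann_act n g (z : subvs_of (Ann n)) : subvs_of (Ann n) :=
  Subvs (Ann_stable g (subvsP z)).

Lemma Ann_act_is_linear n g : linear (@Ann_act n g).
Proof.
move=> a x y; apply: val_inj; apply/lfunP => f.
by rewrite /= !(comp_lfunE, add_lfunE, scale_lfunE).
Qed.

HB.instance Definition _ n g :=
  GRing.isLinear.Build 'F_2 (subvs_of (Ann n)) (subvs_of (Ann n)) _
    (@Ann_act n g) (@Ann_act_is_linear n g).

(* The coinvariants of a module M are M / <g z - z | g in GL_h, z in M>. *)
Definition coinv_rel n : {vspace subvs_of (Ann n)} :=
  (\sum_(g : {'GL_h['F_2]}) limg (linfun (@Ann_act n g) - \1%VF))%VS.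

Definition coinv n := quotv (coinv_rel n).

Definition coinv_class n (z : dual n) (zA : z \in Ann n) : coinv n :=
  quot_pi (coinv_rel n) (Subvs zA).

Definition dual_mon_fun n (m : 'X_{1..h.-1.+1}) (f : P_[n]) : ('F_2)^o := f@_m.

Lemma dual_mon_fun_is_linear n m : linear (@dual_mon_fun n m).
Proof. by move=> a x y; rewrite /dual_mon_fun /= mcoeffD mcoeffZ. Qed.

HB.instance Definition _ n m :=
  GRing.isLinear.Build 'F_2 P_[n] ('F_2)^o _ (@dual_mon_fun n m)
    (@dual_mon_fun_is_linear n m).

(* x_1^(a_1) ... x_h^(a_h), dual to t_1^(a_1) ... t_h^(a_h) in the monomial
   basis of the degree n part, for a = [:: a_1; ...; a_h] of sum n. *)
Definition divpow n (a : seq nat) : dual n :=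
  linfun (@dual_mon_fun n [multinom nth 0%N a i | i < h.-1.+1]).

End SteenrodAction.

Definition n3 : nat := (5 * 2 ^ 3 - 2)%N.

Lemma n3E : n3 = 38%N. Proof. by []. Qed.

Definition zeta_tilde_exponents : seq (seq nat) := (
  [:: [:: 11; 11; 11; 5]; [:: 11; 11; 13; 3]; [:: 7; 11; 17; 3]; [:: 11; 7; 17; 3];
    [:: 7; 13; 15; 3]; [:: 11; 15; 9; 3]; [:: 15; 11; 9; 3]; [:: 7; 19; 9; 3];
    [:: 19; 7; 9; 3]; [:: 7; 19; 7; 5]; [:: 19; 7; 7; 5]; [:: 11; 19; 5; 3];
    [:: 19; 11; 5; 3]; [:: 11; 21; 3; 3]; [:: 19; 13; 3; 3]; [:: 7; 23; 5; 3];
    [:: 23; 7; 5; 3]; [:: 11; 11; 7; 9]; [:: 11; 7; 11; 9]; [:: 7; 11; 11; 9];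
    [:: 7; 25; 3; 3]; [:: 23; 9; 3; 3]; [:: 15; 17; 3; 3]; [:: 15; 15; 3; 5];
    [:: 27; 5; 3; 3]; [:: 29; 3; 3; 3]; [:: 13; 11; 7; 7]; [:: 11; 7; 13; 7];
    [:: 7; 13; 11; 7]; [:: 13; 7; 7; 11]; [:: 7; 7; 13; 11]; [:: 7; 13; 7; 11];
    [:: 11; 7; 7; 13]; [:: 7; 11; 7; 13]; [:: 7; 7; 11; 13]; [:: 7; 7; 7; 17];
    [:: 7; 7; 9; 15]; [:: 7; 11; 5; 15]; [:: 7; 13; 3; 15]; [:: 7; 7; 19; 5];
    [:: 7; 7; 21; 3]; [:: 11; 7; 15; 5]; [:: 11; 15; 7; 5]; [:: 15; 11; 7; 5]])%N.

Definition zeta_tilde : 'Hom(dhomog 4 'F_2 n3, ('F_2)^o) :=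
  \sum_(a <- zeta_tilde_exponents) divpow 4 n3 a.

(* Main.v *)
(* A functional z in [P_38]^* is recorded by its values c(m) = z(t^m); it lies
   in Ann iff c sums to zero over the monomials of Sq^k(t^m) for all m and all
   k > 0.  Sparse Gaussian elimination on these relations expresses every c(m)
   through 192 free values.  The transforms of x = x_3^(7) x_4^(31) and of
   zeta under transvections give 192 independent vectors in these coordinates,
   so x and zeta generate Ann as a GL_4-module and their classes span the
   coinvariants.  The classes are independent because two polynomials, which
   are GL_4-invariant modulo hit polynomials, separate them; invariance has
   only to be tested on transvections, since these generate GL_4(F_2). *)

From HB Require Import structures.
From Stdlib Require Import PArith FMapPositive.
Require Import Defs.
From mathcomp Require Import all_boot all_order all_algebra all_fingroup all_field.
From mathcomp Require Import zify.
From mathcomp Require generic_quotient.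
From mathcomp.multinomials Require Import mpoly.

Set Implicit Arguments.
Unset Strict Implicit.
Unset Printing Implicit Defensive.

Import GRing.Theory.

(** Soundness of the elimination suffices. If the listed relations hold on Ann and write every c(m)
    as a sum of free values, an element of Ann is determined by its free coordinates. If moreover
    sums of transforms of x and zeta realise every unit vector of these coordinates, such sums
    exhaust Ann. Having a class in the span of [x] and [zeta] is stable under sums and under GL_4,
    so this property is simply carried along the search. Masks, tables and detectors are untrusted
    data: [certificate] tests them, and its consequences are drawn for an arbitrary table [nt] and
    list [D], so that the large tables are evaluated only in [certificate_ok]. *)

Module PM := PositiveMap.

(* A list of exponent vectors stands for the sum of the corresponding monomials
   over F_2.  On lexicographically decreasing lists [xmerge] is addition with
   cancellation; the order only matters for termination of the elimination,
   never for soundness. *)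
Local Notation terms := (seq (seq nat)).
Local Notation table := (PM.t (seq (seq nat))).

(** * Sums of monomials over F_2 and sparse elimination *)

Fixpoint lcmp (a b : seq nat) : comparison :=
  match a, b with
  | [::], [::] => Eq
  | [::], _ => Lt
  | _, [::] => Gt
  | x :: a', y :: b' => match Nat.compare x y with Eq => lcmp a' b' | o => o end
  end.

Fixpoint xmerge (r1 : terms) : terms -> terms :=
  match r1 with
  | [::] => fun r2 => r2
  | x :: r1' =>
    fix aux (r2 : terms) :=
      match r2 with
      | [::] => r1
      | y :: r2' =>
        match lcmp x y with
        | Eq => xmerge r1' r2'
        | Gt => x :: xmerge r1' r2
        | Lt => y :: aux r2'
        end
      end
  end.

Fixpoint pairs (rs : seq terms) : seq terms :=
  if rs is r1 :: r2 :: rs' then xmerge r1 r2 :: pairs rs' else rs.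

(** Balanced merging in pairs, for speed; when the [k] rounds run out, a plain fold still gives the
    right sum. *)
Fixpoint msum_rec (k : nat) (rs : seq terms) : terms :=
  match rs, k with
  | [::], _ => [::]
  | [:: r], _ => r
  | _, 0 => foldr xmerge [::] rs
  | _, k'.+1 => msum_rec k' (pairs rs)
  end.

Definition msum := msum_rec 20.

(** Each exponent is coded in unary and closed by [xI]: a prefix code, hence injective, with short
    paths since the exponents add up to at most 38. *)
Fixpoint mkey (m : seq nat) : positive :=
  if m is a :: m' then iter a xO (xI (mkey m')) else xH.

(* A row that is not reduced within [fuel] steps is dropped: this loses a
   relation but is sound. *)
Fixpoint add_row (fuel : nat) (t : table) (r : terms) : table :=
  match fuel, r with
  | f.+1, m :: _ =>
    match PM.find (mkey m) t with
    | None => PM.add (mkey m) r t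
    | Some q => add_row f t (xmerge r q)
    end
  | _, _ => t
  end.

(* A monomial absent from the table is its own normal form, so that [nf] is
   sound whatever the table contains. *)
Definition nf (t : table) (m : seq nat) : terms :=
  if PM.find (mkey m) t is Some r then r else [:: m].

Definition nf_sum (t : table) (r : terms) : terms := msum [seq nf t b | b <- r].

(** Back substitution. Rows are lexicographically decreasing and [comps] is increasing, so the
    monomials of the tail [q] already have their final normal form in [nt]. *)
Definition nf_step (t nt : table) (m : seq nat) : table :=
  match PM.find (mkey m) t with
  | Some (_ :: q) => PM.add (mkey m) (nf_sum nt q) nt
  | _ => nt
  end.

Definition nf_table (t : table) (ms : terms) : table :=
  foldl (nf_step t) (PM.empty _) ms.

Definition toset (r : terms) : table := foldr (fun m => PM.add (mkey m) [::]) (PM.empty _) r.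

Definition inset (s : table) (m : seq nat) : bool :=
  if PM.find (mkey m) s is Some _ then true else false.

(** * Binomial coefficients mod 2, squares and substitutions of monomials *)

Fixpoint pascal2 n :=
  if n is n'.+1 then
    let r := pascal2 n' in [seq p.1 (+) p.2 | p <- zip (false :: r) (rcons r false)]
  else [:: true].

(** The j with Sq^j t^n = t^(n+j), in decreasing order so that [sq_terms] is lexicographically
    decreasing. *)
Definition odd_bins n := [seq j <- rev (iota 0 n.+1) | nth false (pascal2 n) j].
(** The exponents m such that t^a occurs in the total square of t^m. *)
Definition odd_bins_dual a :=
  [seq m <- rev (iota 0 a.+1) | nth false (pascal2 m) (a - m)].

Definition odd_bins_tab := Eval vm_compute in mkseq odd_bins 39.
(* Junk ([::]) for n > 38. *)
Definition odd_bins39 n := nth [::] odd_bins_tab n.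

(* [sb] is [odd_bins], or [odd_bins39] in computations. *)
Section Lists.
Variable sb : nat -> seq nat.

Fixpoint sq_terms k (m : seq nat) : terms :=
  match m with
  | [::] => if k is 0 then [:: [::]] else [::]
  | a :: m' =>
    flatten [seq if Nat.leb j k then [seq (j + a) :: t | t <- sq_terms (k - j) m']
                 else [::] | j <- sb a]
  end.

(** The monomial after the substitution of t_j + t_i for t_j. *)
Definition transv i j (m : seq nat) : terms :=
  [seq set_nth 0 (set_nth 0 m j (nth 0 m j - r)) i (r + nth 0 m i)
     | r <- sb (nth 0 m j)].
End Lists.

Fixpoint sq_total_terms (m : seq nat) : terms :=
  if m is a :: m' then flatten [seq [seq (j + a) :: t | t <- sq_total_terms m'] | j <- odd_bins a]
  else [:: [::]].

Fixpoint sq_dual_terms (m : seq nat) : terms :=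
  if m is a :: m' then flatten [seq [seq j :: t | t <- sq_dual_terms m'] | j <- odd_bins_dual a]
  else [:: [::]].

(** * The hit relations in degree 38 *)

Fixpoint comps (h n : nat) : terms :=
  match h with
  | 0 => if n is 0 then [:: [::]] else [::]
  | h'.+1 => flatten [seq [seq a :: t | t <- comps h' (n - a)] | a <- iota 0 n.+1]
  end.

Fixpoint mask_bits (p : positive) (s : terms) : terms :=
  match p, s with
  | xO p', _ :: s' => mask_bits p' s'
  | xI p', m :: s' => m :: mask_bits p' s'
  | _, _ => [::]
  end.

Definition add_hits fuel k (ms : terms) (t : table) : table :=
  foldl (fun t m => add_row fuel t (sq_terms odd_bins39 k m)) t ms.

(* Bit i tells whether Sq^k of the i-th monomial of degree 38 - k is independent
   of the relations treated before it.  For k = 1, 2 a small fuel filters out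
   the dependent ones, and Sq^16 brings nothing new. *)
Definition hits4 : positive := 0x19ec0000f6e300000000000000000000000000000000000000000000000000000000009c3e07f00ff801ffeaac00000000000000000000000f6003fd580000fff556eee33300000000000000000000000000000000000000000000000000000000000000000000000000000000000000000000000000000000000000000000000000000000000000000000000000000000000000000000000000000000000000000000000009c3e07f00ff801ffc003ffe0007fff0000ffff80001ffffeaaaac0000000000000000000000000000000000000000000000000000000000f6003fd580000fff5560000003fffd555800000000fffff55556eeeee333330000000000000000000000000000000000000000000000000000000000000000000000000000000000000000000000000000000000000000000000000000000000000000000000000000000000000000000000000000000000000000000000000000000000000000000000000000000000000000000000000000000000000000000000000000000000000000000000000000000000000000000000000000000000000000000000000000000000000000000000000000000000000000000000000000000000000000000000009c3e07f00ff801ffc003ffe0007fff0000ffff80001ffffc00003ffffe000007fffff000000ffffff8000001ffffffeaaaaaac0000000000000000000000000000000000000000000000000000000000000000000000000000000000000000000000000000000000000f6003fd580000fff5560000003fffd555800000000fffff5555600000000003fffffd555558000000000000fffffff5555556eeeeeee3333333000000000000000000000000000000000000000000000000000000000000000000000000000000000000000000000000000000000000000000000000000027b7000003fe007ffaab777000000000003fffe00007ffffaaaab77777000000020200000003fffffe0000007ffffffaaaaaabf77777f99999999e3e3e3fec2c2c2ec000000000000000000000000000000000000000000000000000000000000000000000000000000000000000000000000000000000000000000000000000000000000000000003db8c000000003ffd55bbb8ccc00000000000000003ffffd5555bbbbb8ccccc0000000000000000000000003ffffffd555555bbbbbbb8cccccccf1f1f1ff61616176e0e0e0ee3030303300b0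1800000000000aab0001998000000000000000000000aaaab000001999980000000000000000000000000000000aaaaaab00000001999999800000002c2c2c2ec0000000060606066080808088.
Definition hits8 : positive := 0x180140000055000000001554000488b80030000000000000000000000000000000000000000000000000000000000000000000000000000000000000000000000000000000000000000000000000000000000050020000000000000555000022200001415400000808800000000000000000000000000000000000000000000000000000000000000000000000000000000000000000000000000000000000000000000000000000000000000000000000000000000000000000000000000000000000000000000000000000000000055000000001554000088800005555000002022000000155400000000888000000000000000000000000000000000000000000000000000000000000000000000000000000000000000000000000000000000000000000000000000000000000000000000000000000000000000000000000000000000000000000000000000000000000000000000000000000000000000000000000000000000000000000000000000000000000000000000000005550001222c000141540000080880000005550000000022a00000000015400000000000b800000200000000000000000000000000000000000000000000000000000000000000000000000000000000000000000000000000000000000000000000000000000000000000000091170006000000000404400000000000000000111000000000000000000000005c00000100000038000000c0000000000000000000000000000000008003000000000000000000000000000000000000000000000000000000000000000080000000000000600000008000.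

(** The squares Sq^(2^i) generate the Steenrod algebra, whence the choice of k = 1, 2, 4, 8. *)
Definition hits : table :=
  add_hits 100 8 (mask_bits hits8 (comps 4 30))
  (add_hits 100 4 (mask_bits hits4 (comps 4 34))
  (add_hits 4 2 (comps 4 36)
  (add_hits 1 1 (comps 4 37) (PM.empty _)))).

(** * Coordinates on Ann, search through the orbits, and the certificate *)

Definition degree38 : terms := comps 4 38.
Definition nf38 : table := nf_table hits degree38.
Definition basis38 : terms := [seq m <- rev degree38 | ~~ inset hits m].

(** Row d gives the value of gz at d in terms of the coordinates of z. The dual action uses the
    inverse of g, which is g itself for a transvection over F_2. *)
Definition transv_mx (nt : table) (D : terms) (g : nat * nat) : seq (seq nat * terms) :=
  [seq (d, nf_sum nt (transv odd_bins39 g.1 g.2 d)) | d <- D].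

(* [toggle] keeps parities: exponent vectors occurring twice cancel. *)
Definition toggle (m : seq nat) (s : table) : table :=
  if inset s m then PM.remove (mkey m) s else PM.add (mkey m) [::] s.

Definition act (M : seq (seq nat * terms)) (v : terms) : terms :=
  let s := foldr toggle (PM.empty _) v in
  [seq p.1 | p <- M & foldr (fun b o => inset s b (+) o) false p.2].

(* Depth-first search through the vectors (g - 1) v; the bits of [p] select those
   that are independent of the vectors found before. *)
Fixpoint orbit_table (p : positive) (Ms : seq (seq (seq nat * terms)))
    (st : seq (terms * seq (seq nat * terms))) (t : table) : table :=
  match p, st with
  | xO p', _ :: st' => orbit_table p' Ms st' t
  | xI p', (v, M) :: st' =>
    let w := xmerge (act M v) v in
    orbit_table p' Ms ([seq (w, M') | M' <- Ms] ++ st') (add_row 200 t w)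
  | _, _ => t
  end.

(** Triangularity: the row with leading monomial d involves otherwise only monomials already
    treated, so subtracting their unit vectors leaves the unit vector of d. *)
Fixpoint spans_units (t : table) (ds : terms) (known : table) : bool :=
  if ds is d :: ds' then
    if PM.find (mkey d) t is Some (_ :: q) then
      all (inset known) q && spans_units t ds' (PM.add (mkey d) [::] known)
    else false
  else true.

Definition coords (D L : terms) : terms := let s := toset L in [seq d <- D | inset s d].

Definition terms_eq (r1 r2 : terms) : bool := nilp (xmerge r1 r2).

Definition offdiag : seq (nat * nat) :=
  [seq p <- [seq (i, j) | i <- iota 0 4, j <- iota 0 4] | ~~ eqn p.1 p.2].

Definition invariant_terms (nt : table) (p : terms) : bool :=
  let r := nf_sum nt p in
  all (fun g => terms_eq (nf_sum nt (flatten [seq transv odd_bins39 g.1 g.2 m | m <- p])) r)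
    offdiag.

(** All Sq^k are treated at once: a functional is annihilated by every Sq^k with k > 0 exactly when
    the dual of the total square fixes it, that is, when only Sq^0 contributes. *)
Definition annihilated_terms (L : terms) : bool :=
  terms_eq (msum [seq sq_dual_terms a | a <- L]) (msum [seq [:: a] | a <- L]).

Definition orbit_mask : positive := 0xc001801000a000001000480096080100108960c4b0894640088000004000028000000000110060024225808000002000064004b045000000040000a000c0020c4a18960c246612c4b08946430000000100009609800000000000500060010048625848cb062428800010020044b060004000000000000000020114228312c000002200312c0202250c4b04c2465.

(** The transvections between neighbouring indices; their commutators give the remaining ones. *)
Definition orbit_gens : seq (nat * nat) := [:: (2, 3); (0, 1); (3, 2); (1, 0); (2, 1); (1, 2)].

Definition x_exponents : terms := [:: [:: 0; 0; 7; 31]].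

(* The two invariants of the cohit module in degree 38, found by solving the
   linear system of [invariant_terms]. *)
Definition zeta_detector : terms := [::
    [:: 3; 3; 3; 29]; [:: 3; 3; 7; 25]; [:: 3; 7; 3; 25]; [:: 3; 7; 7; 21];
    [:: 7; 3; 3; 25]; [:: 7; 3; 7; 21]; [:: 7; 7; 3; 21]; [:: 7; 7; 7; 17]].

Definition x_detector : terms := [::
    [:: 0; 0; 7; 31]; [:: 0; 0; 15; 23]; [:: 0; 0; 31; 7]; [:: 0; 1; 6; 31];
    [:: 0; 1; 7; 30]; [:: 0; 1; 14; 23]; [:: 0; 1; 15; 22]; [:: 0; 1; 30; 7];
    [:: 0; 1; 31; 6]; [:: 0; 3; 5; 30]; [:: 0; 3; 13; 22]; [:: 0; 3; 29; 6];
    [:: 0; 7; 0; 31]; [:: 0; 7; 1; 30]; [:: 0; 7; 31; 0]; [:: 0; 15; 0; 23];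
    [:: 0; 15; 1; 22]; [:: 0; 15; 23; 0]; [:: 0; 31; 0; 7]; [:: 0; 31; 1; 6];
    [:: 0; 31; 7; 0]; [:: 1; 0; 6; 31]; [:: 1; 0; 7; 30]; [:: 1; 0; 14; 23];
    [:: 1; 0; 15; 22]; [:: 1; 0; 30; 7]; [:: 1; 0; 31; 6]; [:: 1; 1; 5; 31];
    [:: 1; 1; 6; 30]; [:: 1; 1; 7; 29]; [:: 1; 1; 14; 22]; [:: 1; 1; 15; 21];
    [:: 1; 1; 29; 7]; [:: 1; 1; 30; 6]; [:: 1; 1; 31; 5]; [:: 1; 3; 4; 30];
    [:: 1; 3; 12; 22]; [:: 1; 3; 13; 21]; [:: 1; 3; 28; 6]; [:: 1; 3; 29; 5];
    [:: 1; 6; 0; 31]; [:: 1; 6; 1; 30]; [:: 1; 6; 31; 0]; [:: 1; 7; 0; 30];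
    [:: 1; 7; 1; 29]; [:: 1; 7; 30; 0]; [:: 1; 14; 0; 23]; [:: 1; 14; 1; 22];
    [:: 1; 14; 23; 0]; [:: 1; 15; 0; 22]; [:: 1; 15; 1; 21]; [:: 1; 15; 22; 0];
    [:: 1; 30; 0; 7]; [:: 1; 30; 1; 6]; [:: 1; 30; 7; 0]; [:: 1; 31; 0; 6];
    [:: 1; 31; 1; 5]; [:: 1; 31; 6; 0]; [:: 3; 0; 5; 30]; [:: 3; 0; 13; 22];
    [:: 3; 0; 29; 6]; [:: 3; 1; 13; 21]; [:: 3; 1; 29; 5]; [:: 3; 3; 5; 27];
    [:: 3; 3; 9; 23]; [:: 3; 3; 11; 21]; [:: 3; 3; 27; 5]; [:: 3; 5; 0; 30];
    [:: 3; 5; 1; 29]; [:: 3; 5; 30; 0]; [:: 3; 13; 0; 22]; [:: 3; 13; 1; 21];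
    [:: 3; 13; 22; 0]; [:: 3; 29; 0; 6]; [:: 3; 29; 1; 5]; [:: 3; 29; 6; 0];
    [:: 7; 0; 0; 31]; [:: 7; 0; 1; 30]; [:: 7; 0; 31; 0]; [:: 7; 1; 0; 30];
    [:: 7; 1; 1; 29]; [:: 7; 1; 30; 0]; [:: 7; 31; 0; 0]; [:: 15; 0; 0; 23];
    [:: 15; 0; 1; 22]; [:: 15; 0; 23; 0]; [:: 15; 1; 0; 22]; [:: 15; 1; 1; 21];
    [:: 15; 1; 22; 0]; [:: 15; 23; 0; 0]; [:: 31; 0; 0; 7]; [:: 31; 0; 1; 6];
    [:: 31; 0; 7; 0]; [:: 31; 1; 0; 6]; [:: 31; 1; 1; 5]; [:: 31; 1; 6; 0];
    [:: 31; 7; 0; 0]].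

Definition certificate (nt : table) (D : terms) : bool :=
  let Ds := toset D in
  let Ms := [seq transv_mx nt D g | g <- orbit_gens] in
  let vx := coords D x_exponents in
  let vz := coords D zeta_tilde_exponents in
  [&& annihilated_terms x_exponents, annihilated_terms zeta_tilde_exponents,
      all (fun m => all (inset Ds) (nf nt m)) degree38,
      invariant_terms nt x_detector, invariant_terms nt zeta_detector,
      all (fun M => all (fun p => all (inset Ds) p.2) M) Ms &
      spans_units (orbit_table orbit_mask Ms
          ([seq (vz, M) | M <- Ms] ++ [seq (vx, M) | M <- Ms])
          (add_row 200 (add_row 200 (PM.empty _) vx) vz))
        (rev D) (PM.empty _)].

Lemma certificate_ok : certificate nf38 basis38 = true.
Proof. by vm_compute. Qed.

Local Open Scope ring_scope.

(** * Soundness of the sparse elimination *)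

Lemma lcmp_eq a b : lcmp a b = Eq -> a = b.
Proof.
elim: a b => [|x a IHa] [|y b] //=.
case: (PeanoNat.Nat.compare_spec x y) => // -> /IHa -> //.
Qed.

Lemma iter_xO_inj a b p q : iter a xO (xI p) = iter b xO (xI q) -> a = b /\ p = q.
Proof. by elim: a b => [|a IHa] [|b] //= [] // /IHa [-> ->]. Qed.

Lemma mkey_inj : injective mkey.
Proof.
elim=> [|a m IHm] [|b n] //=; first by case: b.
  by case: a.
by case/iter_xO_inj=> -> /IHm ->.
Qed.

Lemma F2_addxx (x : 'F_2) : x + x = 0.
Proof. by rewrite -mulr2n -mulr_natr pchar_Zp // mulr0. Qed.

Lemma F2_oppr (x : 'F_2) : - x = x.
Proof. by apply/eqP; rewrite eq_sym -addr_eq0 F2_addxx. Qed.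

Lemma F2_cases (x : 'F_2) : x = 0 \/ x = 1.
Proof. by case: x => -[|[|k]] //= i; [left | right]; apply/val_inj. Qed.

Definition rsum (c : seq nat -> 'F_2) (r : terms) : 'F_2 := \sum_(m <- r) c m.

Definition delta (m b : seq nat) : 'F_2 := (b == m)%:R.

Section Val.
Variable c : seq nat -> 'F_2.

Lemma rsum_cons m r : rsum c (m :: r) = c m + rsum c r.
Proof. exact: big_cons. Qed.

Lemma rsum_nil : rsum c [::] = 0. Proof. exact: big_nil. Qed.

Lemma rsum_seq1 m : rsum c [:: m] = c m. Proof. exact: big_seq1. Qed.

Lemma rsum_cat r1 r2 : rsum c (r1 ++ r2) = rsum c r1 + rsum c r2.
Proof. exact: big_cat. Qed.

Lemma rsum_xmerge r1 r2 : rsum c (xmerge r1 r2) = rsum c r1 + rsum c r2.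
Proof.
elim: r1 r2 => [|x r1 IH1] r2 /=; first by rewrite rsum_nil add0r.
elim: r2 => [|y r2 IH2]; first by rewrite rsum_nil addr0.
case E: (lcmp x y).
- by rewrite IH1 !rsum_cons (lcmp_eq E) addrACA F2_addxx add0r.
- by rewrite rsum_cons IH2 !rsum_cons addrCA.
- by rewrite rsum_cons IH1 !rsum_cons addrA.
Qed.

Lemma rsum_pairs rs : \sum_(r <- pairs rs) rsum c r = \sum_(r <- rs) rsum c r.
Proof.
move: {2}(size rs) (leqnn (size rs)) => n.
elim: n rs => [|n IHn] [|r1 [|r2 rs]] //= /ltnW; rewrite ltnS => le_n.
by rewrite !big_cons IHn // rsum_xmerge addrA.
Qed.

Lemma rsum_msum rs : rsum c (msum rs) = \sum_(r <- rs) rsum c r.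
Proof.
rewrite /msum; elim: 20%N rs => [|n IHn] [|r1 [|r2 rs]];
  rewrite ?big_nil ?big_seq1 ?rsum_nil //.
  change (rsum c (foldr xmerge [::] [:: r1, r2 & rs]) = \sum_(r <- [:: r1, r2 & rs]) rsum c r).
  elim: [:: r1, r2 & rs] => [|r l IHl] /=; first by rewrite big_nil rsum_nil.
  by rewrite big_cons rsum_xmerge IHl.
change (rsum c (msum_rec n (pairs [:: r1, r2 & rs])) = \sum_(r <- [:: r1, r2 & rs]) rsum c r).
by rewrite IHn rsum_pairs.
Qed.

Lemma rsum_flatten rs : rsum c (flatten rs) = \sum_(r <- rs) rsum c r.
Proof. by elim: rs => [|r rs IH]; rewrite ?big_nil ?rsum_nil //= rsum_cat IH big_cons. Qed.

End Val.

Lemma rsum_delta m r : uniq r -> rsum (delta m) r = (m \in r)%:R.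
Proof.
elim: r => [|b r IHr] /=; first by rewrite rsum_nil.
case/andP=> nbr /IHr IH; rewrite rsum_cons IH in_cons /delta eq_sym.
by case: eqP nbr => [-> /negPf->|_ _] /=; rewrite ?addr0 ?add0r.
Qed.

Arguments xmerge : simpl never.

Section AddRow.
Variable V : terms -> Prop.
Hypothesis V_xmerge : forall r1 r2, V r1 -> V r2 -> V (xmerge r1 r2).

(** [V] has two uses: the relations that vanish on a fixed functional, and the coordinate vectors
    realised by suitable functionals. *)
Definition tab_ok (t : table) :=
  forall k r, PM.find k t = Some r -> V r /\ k = mkey (head [::] r).

Lemma tab_ok_empty : tab_ok (PM.empty _).
Proof. by move=> k r; rewrite PM.gempty. Qed.

Lemma tab_ok_add_row fuel t r : tab_ok t -> V r -> tab_ok (add_row fuel t r).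
Proof.
move=> tP; elim: fuel r => [|f IHf] [|m r] //= rP.
case E: (PM.find (mkey m) t) => [q|].
  by apply: IHf; apply: V_xmerge => //; case: (tP _ _ E).
move=> k r'; rewrite PositiveMapAdditionalFacts.gsspec.
case: PositiveMap.E.eq_dec => [->|_] /=; last exact: tP.
by case=> <-.
Qed.
End AddRow.

Section NormalForm.
Variables (c : seq nat -> 'F_2) (t : table).
Hypothesis t_ok : tab_ok (fun r => rsum c r = 0) t.

Definition nf_ok (nt : table) :=
  forall m r, PM.find (mkey m) nt = Some r -> c m = rsum c r.

Lemma rsum_nf nt m : nf_ok nt -> rsum c (nf nt m) = c m.
Proof.
rewrite /nf => ntP; case E: (PM.find _ nt) => [r|]; last exact: rsum_seq1.
by rewrite -(ntP _ _ E).
Qed.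

Lemma rsum_nf_sum nt r : nf_ok nt -> rsum c (nf_sum nt r) = rsum c r.
Proof.
move=> ntP; rewrite /nf_sum rsum_msum big_map; apply: eq_bigr => m _.
exact: rsum_nf.
Qed.

Lemma nf_table_ok ms : nf_ok (nf_table t ms).
Proof.
rewrite /nf_table; have: nf_ok (PM.empty _) by move=> m r; rewrite PM.gempty.
elim: ms (PM.empty _) => [|m ms IHms] nt ntP //=; apply: IHms.
rewrite /nf_step; case E: (PM.find _ t) => [[|p q]|] // b r.
have [/eqP + /= /mkey_inj mp] := t_ok E; rewrite rsum_cons addr_eq0 F2_oppr => /eqP cp.
rewrite PositiveMapAdditionalFacts.gsspec.
case: PositiveMap.E.eq_dec => [/mkey_inj ->|_]; last exact: ntP.
by case=> <-; rewrite rsum_nf_sum // mp cp.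
Qed.
End NormalForm.

Lemma in_inset r m : inset (toset r) m = (m \in r).
Proof.
rewrite /inset; elim: r => [|b r IHr] /=; first by rewrite PM.gempty.
rewrite PositiveMapAdditionalFacts.gsspec in_cons.
case: PositiveMap.E.eq_dec => [/mkey_inj->|nE]; first by rewrite eqxx.
by rewrite IHr; case: eqP => // mb; case: nE; rewrite mb.
Qed.

(** * Total squares of monomials and their duals *)

Lemma nth_pascal2 n j : nth false (pascal2 n) j = odd 'C(n, j).
Proof.
have sz k : size (pascal2 k) = k.+1.
  by elim: k => //= k IHk; rewrite size_map size_zip /= size_rcons IHk minnn.
elim: n j => [|n IHn] j; first by case: j => [|[|j]].
case: (ltnP j n.+2) => [lt_j|ge_j]; last first.
  by rewrite nth_default ?sz // bin_small.
rewrite /= (nth_map (false, false)); last by rewrite size_zip /= size_rcons sz minnn.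
rewrite nth_zip /= ?size_rcons ?sz // nth_rcons sz.
case: j lt_j => [_|j lt_j] /=; first by rewrite IHn !bin0.
rewrite !IHn binS oddD addbC; congr (_ (+) _).
by rewrite if_same; case: ltnP => // ge_j; rewrite bin_small.
Qed.

Lemma mem_odd_bins n j : (j \in odd_bins n) = odd 'C(n, j).
Proof.
rewrite mem_filter nth_pascal2 mem_rev mem_iota /= add0n.
by case: ltnP => [_|lt_j]; rewrite ?andbT // andbF bin_small.
Qed.

Lemma odd_bins_le n j : j \in odd_bins n -> (j <= n)%N.
Proof. by rewrite mem_filter mem_rev mem_iota add0n ltnS => /and3P[]. Qed.

Lemma mem_odd_bins_dual a m : (m \in odd_bins_dual a) = (m <= a)%N && odd 'C(m, a - m).
Proof. by rewrite mem_filter nth_pascal2 mem_rev mem_iota add0n ltnS andbC. Qed.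

Lemma uniq_odd_bins n : uniq (odd_bins n).
Proof. by rewrite filter_uniq // rev_uniq iota_uniq. Qed.

Lemma uniq_odd_bins_dual n : uniq (odd_bins_dual n).
Proof. by rewrite filter_uniq // rev_uniq iota_uniq. Qed.

Lemma odd_bins39E n : (n < 39)%N -> odd_bins39 n = odd_bins n.
Proof.
have E : odd_bins_tab = mkseq odd_bins 39 by vm_compute.
by move=> ltn; rewrite /odd_bins39 E nth_mkseq.
Qed.

Lemma exprD_odd_bins (R : comNzRingType) (x y : R) n : 2 \in [pchar R] ->
  (x + y) ^+ n = \sum_(j <- odd_bins n) x ^+ (n - j) * y ^+ j.
Proof.
move=> ch2; rewrite exprDn [RHS]big_filter [RHS]big_mkcond.
rewrite [RHS](perm_big (iota 0 n.+1)); last first.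
  by rewrite perm_rev.
rewrite -(big_mkord xpredT (fun j => x ^+ (n - j) * y ^+ j *+ 'C(n, j))).
rewrite /index_iota subn0; apply: eq_bigr => j _.
rewrite nth_pascal2 -mulr_natr -(GRing.natr_mod_pchar ch2) modn2.
by case: odd; rewrite ?mulr1 ?mulr0.
Qed.

Lemma big_flatten_map (V : nmodType) (S T : Type) (g : S -> seq T) s
    (P : pred T) (F : T -> V) :
  \sum_(t <- flatten [seq g x | x <- s] | P t) F t =
  \sum_(x <- s) \sum_(t <- g x | P t) F t.
Proof. by rewrite big_flatten big_map. Qed.

Lemma sq_terms39E k m : all (ltn^~ 39%N) m -> sq_terms odd_bins39 k m = sq_terms odd_bins k m.
Proof.
elim: m k => [|a m IHm] k //= /andP[lta /IHm IH]; rewrite odd_bins39E //.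
by congr flatten; apply: eq_map => j; rewrite IH.
Qed.

Lemma transv39E i j m : all (ltn^~ 39%N) m -> transv odd_bins39 i j m = transv odd_bins i j m.
Proof.
move=> lt_m; rewrite /transv odd_bins39E //.
by case: (ltnP j (size m)) => [/(all_nthP 0%N lt_m)|/(nth_default 0%N)->].
Qed.

Lemma mem_sq_terms k m t : t \in sq_terms odd_bins k m ->
  size t = size m /\ sumn t = (sumn m + k)%N.
Proof.
elim: m k t => [|a m IHm] [|k] t //=; rewrite ?inE //; first by move/eqP->.
  case/flattenP=> s /mapP[j _ ->]; case: j => //= /mapP[u /IHm[su sumu] ->] /=.
  by rewrite su sumu !addn0.
case/flattenP=> s /mapP[j _ ->]; case: PeanoNat.Nat.leb_spec => // /leP le_j.
case/mapP=> u /IHm[su sumu] -> /=; rewrite su sumu; split=> //; lia.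
Qed.

Lemma mem_sq_total_terms m t : t \in sq_total_terms m -> size t = size m /\ (sumn m <= sumn t)%N.
Proof.
elim: m t => [|a m IHm] t /=; first by rewrite inE => /eqP->.
case/flattenP=> s /mapP[j _ ->] /mapP[u /IHm[su le_u] ->].
by rewrite /= su leq_add // leq_addl.
Qed.

Lemma sum_sq_terms (V : nmodType) (F : seq nat -> V) k m :
  \sum_(t <- sq_terms odd_bins k m) F t =
  \sum_(t <- sq_total_terms m | (sumn t == sumn m + k)%N) F t.
Proof.
elim: m k F => [|a m IHm] k F /=.
  by case: k => [|k]; rewrite !(big_cons, big_nil).
rewrite !big_flatten_map; apply: eq_bigr => j _.
rewrite big_map; case: PeanoNat.Nat.leb_spec => [/leP le_j|/ltP lt_k].
  rewrite big_map IHm; apply: eq_bigl => t /=.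
  by apply/eqP/eqP; lia.
rewrite big_nil big_seq_cond big1 // => t /andP[/mem_sq_total_terms[_ le_t]].
by move/eqP=> /=; lia.
Qed.

(** Both sides are products over the variables; in one variable, with exponents x in [m] and b in
    [a], each factor is the parity of 'C(x, b - x), or 0 if b < x. *)
Lemma sum_sq_dual_terms a m : size a = size m ->
  rsum (delta a) (sq_total_terms m) = rsum (delta m) (sq_dual_terms a).
Proof.
elim: m a => [|x m IHm] [|b a] //= [/IHm IH]; rewrite /rsum !big_flatten_map.
transitivity ((\sum_(j <- odd_bins x) (j + x == b)%:R) * rsum (delta a) (sq_total_terms m)).
  rewrite mulr_suml; apply: eq_bigr => j _; rewrite big_map mulr_sumr.
  by apply: eq_bigr => t _; rewrite /delta eqseq_cons -mulnb natrM.
rewrite IH.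
transitivity ((\sum_(j <- odd_bins_dual b) (j == x)%:R) * rsum (delta m) (sq_dual_terms a)).
  congr (_ * _); rewrite -!natr_sum -!big_mkcond /= !sum1_count.
  rewrite [in RHS]count_uniq_mem ?uniq_odd_bins_dual // mem_odd_bins_dual.
  case: leqP => [le_xb|lt_bx] /=.
    rewrite -(@eq_count _ (pred1 (b - x)%N)); last first.
      by move=> j /=; rewrite -[in RHS](subnK le_xb) eqn_add2r.
    by rewrite count_uniq_mem ?uniq_odd_bins // mem_odd_bins.
  rewrite (@eq_count _ _ pred0) ?count_pred0 // => j /=.
  by apply/eqP => E; rewrite -E ltnNge leq_addl in lt_bx.
rewrite mulr_suml; apply: eq_bigr => j _; rewrite big_map mulr_sumr.
by apply: eq_bigr => t _; rewrite /delta eqseq_cons -mulnb natrM.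
Qed.

Definition pmon (R : nzRingType) (x : nat -> R) (m : seq nat) : R :=
  \prod_(0 <= i < size m) x i ^+ nth 0%N m i.

Lemma pmon_cons (R : nzRingType) (x : nat -> R) a m :
  pmon x (a :: m) = x 0%N ^+ a * pmon (fun i => x i.+1) m.
Proof. by rewrite /pmon big_nat_recl. Qed.

(** In characteristic 2 the factor (x + x^2 X)^a is the sum of x^(a+j) X^j over the j with 'C(a, j)
    odd; splitting off the first variable is the Cartan formula. *)
Lemma coef_sq_total (R : comNzRingType) (x : nat -> R) k m : 2%N \in [pchar R] ->
  (\prod_(0 <= i < size m)
     ((x i)%:P + (x i ^+ 2)%:P * 'X) ^+ nth 0%N m i)`_k =
  \sum_(t <- sq_terms odd_bins k m) pmon x t.
Proof.
move=> ch2; elim: m k x => [|a m IHm] k x.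
  rewrite /= big_nil coef1; case: k => [|k] /=; rewrite ?big_nil //.
  by rewrite big_seq1 /pmon big_nil.
rewrite /= big_nat_recl //= exprD_odd_bins; last by rewrite pchar_poly.
rewrite mulr_suml coef_sum big_flatten_map big_seq [RHS]big_seq.
apply: eq_bigr => j /odd_bins_le le_j.
rewrite exprMn -!rmorphXn /= mulrA -polyCM -exprM -exprD -mulrA coefCM coefXnM.
have -> : (a - j + 2 * j)%N = (j + a)%N by rewrite mul2n -addnn addnA subnK // addnC.
case: PeanoNat.Nat.leb_spec => [/leP le_jk|/ltP lt_kj].
  rewrite ltnNge le_jk /= IHm big_map mulr_sumr.
  by apply: eq_bigr => t _; rewrite pmon_cons.
by rewrite lt_kj mulr0 big_nil.
Qed.

Lemma mem_comps h n m : (m \in comps h n) = (size m == h) && (sumn m == n).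
Proof.
elim: h n m => [|h IHh] n m.
  by case: n => [|n]; case: m => [|a m]; rewrite ?inE.
have -> : comps h.+1 n =
  flatten [seq [seq a :: t | t <- comps h (n - a)] | a <- iota 0 n.+1] by [].
apply/flattenP/andP => [[s /mapP[a]]|].
  rewrite mem_iota add0n ltnS => /andP[_ le_a] -> /mapP[t].
  by rewrite IHh => /andP[/eqP sz /eqP sm] -> /=; rewrite sz sm subnKC.
case: m => [|a m] [] // /eqP[sz] /eqP sm; rewrite /= in sm.
exists [seq a :: t | t <- comps h (n - a)].
  by apply/mapP; exists a; rewrite // mem_iota add0n ltnS -sm leq_addr.
by apply/mapP; exists m; rewrite // IHh sz -sm addKn !eqxx.
Qed.

Arguments comps : simpl never.

Lemma all_lt_sumn n m : (sumn m < n)%N -> all (ltn^~ n) m.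
Proof.
elim: m => //= a m IHm lt_n; rewrite (leq_ltn_trans (leq_addr _ _) lt_n) /=.
by apply: IHm; apply: leq_ltn_trans lt_n; rewrite leq_addl.
Qed.

(** * Functionals as tables of values on monomials *)

Section Coefficients.
Variables h n : nat.
Local Notation N := (h.-1.+1).
Local Notation P := {mpoly 'F_2[N]}.
Local Notation dual := 'Hom(dhomog N 'F_2 n, ('F_2)^o).

Definition mnm_of (m : seq nat) : 'X_{1..N} := [multinom nth 0%N m i | i < N].
Definition mon (m : seq nat) : P := 'X_[mnm_of m].

Lemma mnm_ofK (m : 'X_{1..N}) : mnm_of (multinom_val m) = m.
Proof. by apply/mnmP => i; rewrite mnmE mnm_tnth (tnth_nth 0%N). Qed.

Lemma mdeg_mnm_of m : size m = N -> mdeg (mnm_of m) = sumn m.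
Proof.
move=> sz; rewrite mdegE (eq_bigr (fun i : 'I_N => nth 0%N m i)) => [|i _].
  by rewrite -(big_mkord xpredT (fun i => nth 0 m i)%N) -sz sumnE [RHS](big_nth 0%N).
by rewrite mnmE.
Qed.

Lemma mon_pmon m : size m = N -> mon m = pmon (fun i => 'X_(inord i)) m.
Proof.
move=> sz; rewrite /mon mpolyXE_id /pmon sz big_mkord.
by apply: eq_bigr => i _; rewrite inord_val mnmE.
Qed.

Lemma pchar_mpoly : 2%N \in [pchar P].
Proof. by rewrite pchar_lalg pchar_Fp. Qed.

Lemma Sq_total_mon m : Sq_total (mon m) =
  \prod_(i < N) (('X_i)%:P + ('X_i ^+ 2)%:P * 'X) ^+ nth 0%N m i.
Proof.
rewrite /mon /Sq_total mmapX /mmap1.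
by apply: eq_bigr => i _; rewrite mnmE.
Qed.

Lemma Sq_mon k m : size m = N -> Sq k (mon m) = \sum_(t <- sq_terms odd_bins k m) mon t.
Proof.
move=> sz; rewrite /Sq Sq_total_mon.
have := coef_sq_total (fun i => 'X_(inord i) : P) k m pchar_mpoly.
rewrite sz big_mkord => E.
rewrite (eq_bigr (fun i : 'I_N => (('X_(inord i) : P)%:P +
  (('X_(inord i) : P) ^+ 2)%:P * 'X) ^+ nth 0%N m i)) => [|i _].
  rewrite E big_seq [RHS]big_seq; apply: eq_bigr => t /mem_sq_terms[st _].
  by rewrite mon_pmon // st.
by rewrite inord_val.
Qed.

Lemma SqZ k a (f : P) : Sq k (a *: f) = a *: Sq k f.
Proof.
have SqM p q : Sq_total (p * q) = Sq_total p * Sq_total q :> {poly P} by exact: rmorphM.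
have SqC c : Sq_total c%:MP = (c%:MP)%:P :> {poly P} by exact: mmapC.
by rewrite /Sq -!mul_mpolyC SqM SqC coefCM.
Qed.

Lemma Sq_expand k (f : P) : Sq k f = \sum_(m <- msupp f) f@_m *: Sq k 'X_[m].
Proof.
rewrite {1}[f]mpolyE {1}/Sq (raddf_sum (@Sq_total h)) coef_sum.
by apply: eq_bigr => m _; exact: SqZ.
Qed.

(** The constant coefficient is the value at X = 0, where each factor t + t^2 X becomes t. *)
Lemma Sq0_id f : Sq 0 f = f :> P.
Proof.
rewrite Sq_expand [RHS]mpolyE; apply: eq_bigr => m _; congr (_ *: _).
rewrite /Sq -{1}(mnm_ofK m) -/(mon _) Sq_total_mon -horner_coef0 horner_prod.
rewrite mpolyXE_id; apply: eq_bigr => i _.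
by rewrite !hornerE mnm_tnth (tnth_nth 0%N).
Qed.

Definition ev (z : dual) (f : P) : 'F_2 := z (homcomp n f).

Lemma ev_is_additive z : additive (ev z).
Proof.
move=> p q; rewrite /ev.
have -> : homcomp n (p - q) = homcomp n p - homcomp n q.
  by apply: val_inj; rewrite /= linearB.
exact: (linearB z).
Qed.
HB.instance Definition _ z := GRing.isZmodMorphism.Build P 'F_2 (ev z) (ev_is_additive z).

Lemma evZ z a f : ev z (a *: f) = a * ev z f.
Proof.
rewrite /ev.
have -> : homcomp n (a *: f) = a *: homcomp n f.
  by apply: val_inj; rewrite /= linearZ.
exact: (linearZ_LR z).
Qed.

Definition coefz (z : dual) (m : seq nat) : 'F_2 := ev z (mon m).

Lemma ev_coefz z f : ev z f = \sum_(m <- msupp f) f@_m * coefz z (multinom_val m).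
Proof.
rewrite {1}[f]mpolyE raddf_sum; apply: eq_bigr => m _ /=.
by rewrite evZ /coefz /mon mnm_ofK.
Qed.

Lemma coefz_deg z m : size m = N -> sumn m != n -> coefz z m = 0.
Proof.
move=> sz ne; rewrite /coefz /ev.
have -> : homcomp n (mon m) = 0; last exact: (linear0 z).
apply: val_inj; rewrite /= pihomogX; case: eqP => // E.
by case/eqP: ne; rewrite -E; apply/esym/mdeg_mnm_of.
Qed.

Lemma coefz_inj (z z' : dual) :
  (forall m, size m = N -> sumn m = n -> coefz z m = coefz z' m) -> z = z'.
Proof.
move=> eqz; apply/lfunP => f.
have fE : f = homcomp n (val f).
  by apply: val_inj; rewrite /= pihomog_dE //; exact: (valP f).
rewrite fE -!/(ev _ _) !ev_coefz; apply: eq_bigr => m _; congr (_ * _).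
have sz : size (multinom_val m) = N by rewrite size_tuple.
case: (eqVneq (sumn (multinom_val m)) n) => [|ne]; first exact: eqz.
by rewrite !coefz_deg.
Qed.

Lemma Ann_coefz z k m : z \in Ann h n -> (0 < k)%N -> size m = N ->
  rsum (coefz z) (sq_terms odd_bins k m) = 0.
Proof.
move=> /AnnP zA k0 sz.
have := zA [:: [:: k]] (mon m); rewrite /steenrod_pos /= addn0 k0 => /(_ isT).
by rewrite /steenrod_act big_seq1 /= Sq_mon // -/(ev _ _) raddf_sum.
Qed.

Lemma coefz_Ann z :
  (forall k m, (0 < k)%N -> size m = N -> (sumn m + k = n)%N ->
     rsum (coefz z) (sq_terms odd_bins k m) = 0) -> z \in Ann h n.
Proof.
move=> zP; apply/AnnP.
have zSq k f : (0 < k)%N -> ev z (Sq k f) = 0.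
  move=> k0; rewrite Sq_expand raddf_sum; apply: big1 => m _ /=.
  rewrite evZ -(mnm_ofK m) -/(mon _).
  have sz : size (multinom_val m) = N by rewrite size_tuple.
  rewrite Sq_mon // raddf_sum.
  case: (eqVneq (sumn (multinom_val m) + k)%N n) => [E|ne].
    by rewrite -[X in _ * X]/(rsum (coefz z) _) zP ?mulr0.
  rewrite big_seq big1 ?mulr0 // => t /mem_sq_terms[st sumt].
  by rewrite -[LHS]/(coefz z t) coefz_deg ?st ?sumt.
(* The head of a word is its outermost square: leading Sq^0 are the identity, and the first square
   of positive degree is killed by z whatever it is applied to. *)
have zw w f : (0 < sumn w)%N -> ev z (Sq_seq w f) = 0.
  elim: w => //= -[|k] w IHw; rewrite -/(Sq_seq w f); first by rewrite Sq0_id add0n.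
  by rewrite zSq.
move=> theta f /allP pos; rewrite -/(ev _ _) /steenrod_act raddf_sum.
by rewrite big_seq big1 // => w /pos; exact: zw.
Qed.

Lemma coefz_divpow a t : size a = N -> size t = N -> sumn a = n ->
  coefz (divpow h n a) t = delta a t.
Proof.
move=> sa st suma; rewrite /coefz /ev /divpow lfunE /= /dual_mon_fun /= pihomogX /delta.
have eq_mnm : (mnm_of t == mnm_of a) = (t == a).
  apply/eqP/eqP => [E|-> //]; apply: (@eq_from_nth _ 0%N); first by rewrite sa.
  move=> i; rewrite st => lt_i; have := congr1 (fun m : 'X_{1..N} => m (Ordinal lt_i)) E.
  by rewrite !mnmE.
have -> : (if mdeg (mnm_of t) == n then mon t else 0)@_(mnm_of a) = (t == a)%:R.
  rewrite mdeg_mnm_of //; case: eqP => [_|ne]; first by rewrite mcoeffX eq_mnm.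
  by rewrite mcoeff0; case: eqP ne => // ->; rewrite suma.
by [].
Qed.

Lemma coefz0 m : coefz 0 m = 0.
Proof. by rewrite /coefz /ev lfunE. Qed.

Lemma coefzD z z' m : coefz (z + z') m = coefz z m + coefz z' m.
Proof. by rewrite /coefz /ev add_lfunE. Qed.

Lemma coefz_sum (I : Type) (s : seq I) (F : I -> dual) m :
  coefz (\sum_(i <- s) F i) m = \sum_(i <- s) coefz (F i) m.
Proof. by rewrite /coefz /ev sum_lfunE. Qed.

End Coefficients.

(** * Transvections generate the general linear group over F_2 *)

Section Transvections.
Variable h : nat.
Local Notation N := (h.-1.+1).

(** For i = j the matrix is singular over F_2 and the default 1 is returned. *)
Definition transvection (i j : 'I_N) : {'GL_h['F_2]} :=
  insubd (1%g : {'GL_h['F_2]}) (1%:M + delta_mx i j).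

Lemma transvection_sqr (i j : 'I_N) : i != j ->
  (1%:M + delta_mx i j) *m (1%:M + delta_mx i j) = 1%:M :> 'M['F_2]_N.
Proof.
move=> ne; rewrite mulmxDl mul1mx mulmxDr mulmx1 mul_delta_mx_0 1?eq_sym //.
by rewrite addr0 -addrA -mulr2n -scaler_nat pchar_Zp // scale0r addr0.
Qed.

Lemma transvectionE (i j : 'I_N) : i != j -> GLval (transvection i j) = 1%:M + delta_mx i j.
Proof.
move=> ne; rewrite /transvection /= insubdK //.
by apply/unitrP; exists (1%:M + delta_mx i j); split; exact: transvection_sqr.
Qed.

Lemma transvectionV (i j : 'I_N) : i != j -> (transvection i j)^-1%g = transvection i j.
Proof.
move=> ne; apply: (mulgI (transvection i j)); rewrite mulgV; apply/esym/val_inj.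
by rewrite /= [LHS]GL_ME transvectionE //; exact: transvection_sqr.
Qed.

Lemma mul_transvectionE (g : {'GL_h['F_2]}) (i j r c : 'I_N) : i != j ->
  GLval (g * transvection i j)%g r c = GLval g r c + GLval g r i * (c == j)%:R.
Proof.
move=> ne; rewrite [GLval _]GL_MxE transvectionE // mulmxDr mulmx1 !mxE; congr (_ + _).
rewrite (bigD1 i) //= big1 ?addr0 => [|l nel]; last by rewrite !mxE (negPf nel) mulr0.
by rewrite !mxE eqxx.
Qed.

(* Column operations turn the first k rows into those of the identity. *)
Lemma GL2_ind (Q : {'GL_h['F_2]} -> Prop) : Q 1%g ->
  (forall g i j, i != j -> Q (g * transvection i j)%g -> Q g) -> forall g, Q g.
Proof.
move=> Q1 Qt.
pose P k (g : {'GL_h['F_2]}) :=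
  forall r c : 'I_N, (r < k)%N -> GLval g r c = (r == c)%:R.
suff main d k g : (k + d = N)%N -> P k g -> Q g by move=> g; apply: (main N 0%N).
elim: d k g => [|d IHd] k g kd gP.
  suff -> : g = 1%g by [].
  apply/val_inj/matrixP => r c; rewrite /= [RHS]mxE -[LHS]/(GLval g r c) gP //.
  by rewrite -(addn0 k) kd.
have lt_k : (k < N)%N by lia.
pose k' := Ordinal lt_k.
(* Column i with k <= i vanishes in the first k rows, so adding it to another column does not
   disturb them. *)
have P_column g' (i j : 'I_N) : i != j -> (k <= i)%N -> P k g' -> P k (g' * transvection i j)%g.
  move=> ne le_i gP' r c lt_r; rewrite mul_transvectionE // !gP' //.
  by case: (r =P i) => [E|_]; [move: lt_r; rewrite E ltnNge le_i | rewrite mul0r addr0].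
pose S (g' : {'GL_h['F_2]}) := [set l | (l != k') && (GLval g' k' l != 0)].
have done_row g' : S g' = set0 -> GLval g' k' k' = 1 -> P k g' -> Q g'.
  move=> S0 gkk gP'; apply: (IHd k.+1); first by lia.
  move=> r c; rewrite ltnS leq_eqVlt => /orP[/eqP rk|]; last exact: gP'.
  have -> : r = k' by exact: val_inj.
  case: (eqVneq k' c) => [<-//|ne]; apply/eqP/negPn/negP => nz.
  by move/setP/(_ c): S0; rewrite !inE eq_sym ne nz.
have pivot m g' : (#|S g'| <= m)%N -> GLval g' k' k' = 1 -> P k g' -> Q g'.
  elim: m g' => [|m IHm] g' card gkk gP'; case: (set_0Vmem (S g')) => [S0|[l lS]].
  - exact: done_row.
  - by move: card; rewrite (cardD1 l) lS.
  - exact: done_row.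
  have /andP[ne nz] : (l != k') && (GLval g' k' l != 0) by move: lS; rewrite inE.
  have ne' : k' != l by rewrite eq_sym.
  apply: (Qt _ _ _ ne'); apply: IHm; last exact: P_column.
    apply: leq_trans (_ : #|S g' :\ l| <= m)%N; last first.
      by move: card; rewrite (cardsD1 l) lS.
    apply/subset_leq_card/subsetP => c; rewrite !inE mul_transvectionE // => /andP[-> ].
    case: (eqVneq c l) => [->|_]; last by rewrite mulr0 addr0 => ->.
    by case: (F2_cases (GLval g' k' l)) nz => ->; rewrite ?eqxx // gkk mul1r F2_addxx eqxx.
  by rewrite mul_transvectionE // (negPf ne') mulr0 addr0.
case: (F2_cases (GLval g k' k')) => [gkk|]; last by move=> gkk; exact: (pivot _ g (leqnn _)).
have [j ltj gkj] : exists2 j : 'I_N, (k < j)%N & GLval g k' j != 0.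
  apply/exists_inP; apply: contraT => /exists_inPn noj.
  (* If row k vanished from the diagonal on, it would be a combination of the first k rows, which
     are unit vectors. This v is the resulting linear dependence, impossible for an invertible
     matrix. *)
  pose v : 'rV['F_2]_N := \row_c ((c == k')%:R - (c < k)%N%:R * GLval g k' c).
  have v0 : v *m GLval g = 0.
    apply/rowP => c; rewrite !mxE.
    under eq_bigr do rewrite mxE mulrBl.
    rewrite sumrB (bigD1 k') //= eqxx mul1r big1 ?addr0 => [|r /negPf->]; last by rewrite mul0r.
    apply/eqP; rewrite subr_eq0; apply/eqP.
    case: (ltnP c k) => [lt_c|le_c].
      rewrite (bigD1 c) //= lt_c mul1r (gP c c) // eqxx mulr1 big1 ?addr0 // => r ne.
      by case: ltnP => lt_r; rewrite ?mul0r // (gP r c) // (negPf ne) mulr0.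
    rewrite big1 => [|r _].
      case: (ltngtP c k) le_c => // [/noj/negPn/eqP //|ck] _.
      by have -> : c = k' by exact: val_inj.
    case: ltnP => lt_r; rewrite ?mul0r // (gP r c) // mul1r.
    by case: eqP => [rc|_]; rewrite ?mulr0 //; move: lt_r; rewrite rc ltnNge le_c.
  have: v = 0 by rewrite -[v](mulmxK (GL_unitmx g)) v0 mul0mx.
  by move/rowP/(_ k'); rewrite !mxE eqxx ltnn mul0r subr0 => /eqP; rewrite oner_eq0.
have ne : j != k' by apply: contraTneq ltj => ->; rewrite ltnn.
(* Adding column j to column k makes the pivot 1. *)
apply: (Qt _ _ _ ne); apply: (pivot _ _ (leqnn _)); last exact: P_column (ltnW ltj) _.
rewrite mul_transvectionE // gkk add0r eqxx mulr1.
by case: (F2_cases (GLval g k' j)) gkj => ->.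
Qed.

End Transvections.

(** * The action of transvections and of products on polynomials and functionals *)

Section TransvectionAction.
Variable h : nat.
Local Notation N := (h.-1.+1).

Lemma mon_split (i j : 'I_N) m : i != j ->
  mon h m = 'X_j ^+ nth 0%N m j * ('X_i ^+ nth 0%N m i *
    \prod_(l | (l != j) && (l != i)) 'X_l ^+ nth 0%N m l).
Proof.
move=> ne; have -> : mon h m = \prod_l 'X_l ^+ nth 0%N m l.
  by rewrite /mon mpolyXE_id; apply: eq_bigr => l _; rewrite mnmE.
by rewrite (bigD1 j) //= (bigD1 i).
Qed.

Lemma linsubst_transvection (i j : 'I_N) m : i != j -> size m = N ->
  linsubst (transvection i j) (mon h m) = \sum_(t <- transv odd_bins i j m) mon h t.
Proof.
move=> ne sz; have ne' : j != i by rewrite eq_sym.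
have [A varE ->] : exists2 A : 'I_N -> {mpoly 'F_2[N]},
    forall l, A l = 'X_l + (l == j)%:R *: 'X_i &
    linsubst (transvection i j) (mon h m) = \prod_l A l ^+ nth 0%N m l.
  exists (tnth (linsubst_var (transvection i j))) => [l|].
    rewrite tnth_mktuple transvectionE //.
    under eq_bigr do rewrite !mxE scalerDl.
    rewrite big_split /= (bigD1 l) //= eqxx scale1r big1 ?addr0 => [|r /negPf->].
      congr (_ + _); rewrite (bigD1 i) //= eqxx big1 ?addr0 // => r /negPf->.
      by rewrite scale0r.
    by rewrite scale0r.
  by rewrite /linsubst comp_mpolyX; apply: eq_bigr => l _; rewrite mnmE.
rewrite (bigD1 j) //= (bigD1 i) //= !varE eqxx (negPf ne) scale1r scale0r addr0.
rewrite exprD_odd_bins ?pchar_mpoly // mulr_suml /transv big_map.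
rewrite big_seq [RHS]big_seq; apply: eq_bigr => r /odd_bins_le le_r.
rewrite (mon_split _ ne).
set t := set_nth _ _ i _.
have tE l : nth 0%N t l =
    if l == i then (r + nth 0 m i)%N else if l == j then (nth 0 m j - r)%N else nth 0%N m l.
  by rewrite /t nth_set_nth /= nth_set_nth.
rewrite !tE !eqxx -[nat_of_ord j == _]/(j == i) (negPf ne') -mulrA; congr (_ * _).
rewrite mulrA -exprD; congr (_ * _); apply: eq_bigr => l /andP[lj li].
rewrite varE (negPf lj) scale0r addr0 tE.
by rewrite -[nat_of_ord l == i]/(l == i) -[nat_of_ord l == j]/(l == j) (negPf li) (negPf lj).
Qed.

Lemma coefz_dual_act n (z : 'Hom(dhomog N 'F_2 n, ('F_2)^o)) (i j : 'I_N) m :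
  i != j -> size m = N ->
  coefz (dual_act (transvection i j) z) m = rsum (coefz z) (transv odd_bins i j m).
Proof.
move=> ne sz; rewrite /coefz /ev /dual_act comp_lfunE lfunE /= transvectionV //.
rewrite -[RHS](raddf_sum (ev z)) -linsubst_transvection // /ev; congr (z _).
by apply: val_inj; rewrite /= linsubst_pihomog.
Qed.

End TransvectionAction.

Section Functoriality.
Variable h : nat.
Local Notation N := (h.-1.+1).
Local Notation P := {mpoly 'F_2[N]}.
Implicit Types g k : {'GL_h['F_2]}.

Lemma linsubstXU g i : linsubst g ('X_i : P) = \sum_j GLval g j i *: 'X_j.
Proof. by rewrite /linsubst comp_mpolyXU -tnth_nth tnth_mktuple. Qed.

Lemma linsubst_expand g (f : P) :
  linsubst g f = \sum_(m <- msupp f) f@_m *: \prod_i linsubst g ('X_i : P) ^+ m i.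
Proof.
rewrite {1}/linsubst comp_mpolyEX; apply: eq_bigr => m _; congr (_ *: _).
rewrite comp_mpolyX; apply: eq_bigr => i _.
by rewrite /linsubst comp_mpolyXU -tnth_nth.
Qed.

Lemma linsubst_mulXU g k i :
  linsubst (g * k)%g ('X_i : P) = linsubst g (linsubst k ('X_i : P)).
Proof.
rewrite (linsubstXU (g * k)%g i) (linsubstXU k i) (linear_sum (linsubst g)) /=.
under [RHS]eq_bigr => j _ do rewrite linearZ /= linsubstXU scaler_sumr.
rewrite exchange_big; apply: eq_bigr => j _ /=.
rewrite [(_ * _ : 'M_N) j i]mxE scaler_suml; apply: eq_bigr => l _.
by rewrite [RHS]scalerA; congr (_ *: _); exact: mulrC.
Qed.

(** Both sides are algebra morphisms in f, so the comparison reduces to the variables. *)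
Lemma linsubst_mul g k (f : P) : linsubst (g * k)%g f = linsubst g (linsubst k f).
Proof.
have -> : linsubst g (linsubst k f) =
    \sum_(m <- msupp f) f@_m *: \prod_i linsubst g (linsubst k ('X_i : P)) ^+ m i.
  rewrite (linsubst_expand k f) [LHS](linear_sum (linsubst g)).
  apply: eq_bigr => m _; rewrite [LHS](linearZ_LR (linsubst g)); congr (_ *: _).
  rewrite [LHS](rmorph_prod (linsubst g)); apply: eq_bigr => i _.
  by rewrite [LHS](rmorphXn (linsubst g)).
rewrite (linsubst_expand (g * k)%g f).
have congr_prod (A B : 'I_N -> P) : A =1 B ->
    \sum_(m <- msupp f) f@_m *: \prod_i A i ^+ m i =
    \sum_(m <- msupp f) f@_m *: \prod_i B i ^+ m i.
  by move=> AB; apply: eq_bigr => m _; under eq_bigr do rewrite AB.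
exact: (congr_prod (fun i => linsubst (g * k)%g ('X_i : P))
  (fun i => linsubst g (linsubst k ('X_i : P))) (linsubst_mulXU g k)).
Qed.

Lemma linsubst1 (f : P) : linsubst 1%g f = f.
Proof.
rewrite linsubst_expand [RHS]mpolyE; apply: eq_bigr => m _; congr (_ *: _).
rewrite [RHS]mpolyXE_id; apply: eq_bigr => i _; congr (_ ^+ _).
rewrite linsubstXU; under eq_bigr => j _ do rewrite GL_1E mxE.
rewrite (bigD1 i) //= eqxx scale1r big1 ?addr0 // => j /negPf->.
by rewrite scale0r.
Qed.

Lemma dual_actM n g k (z : 'Hom(dhomog N 'F_2 n, ('F_2)^o)) :
  dual_act (g * k)%g z = dual_act g (dual_act k z).
Proof.
apply/lfunP => f; rewrite /dual_act !comp_lfunE !lfunE /=; congr (z _).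
by apply: val_inj; rewrite /= invMg linsubst_mul.
Qed.

Lemma dual_act1 n (z : 'Hom(dhomog N 'F_2 n, ('F_2)^o)) : dual_act 1%g z = z.
Proof.
apply/lfunP => f; rewrite /dual_act comp_lfunE lfunE /=; congr (z _).
by apply: val_inj; rewrite /= invg1 linsubst1.
Qed.

End Functoriality.

Lemma mem_mask_bits p s : {subset mask_bits p s <= s}.
Proof.
elim: p s => [p IHp|p IHp|] [|m s] //= x; rewrite ?inE //.
  by case/orP=> [->//|/IHp->]; rewrite orbT.
by move/IHp->; rewrite orbT.
Qed.

Lemma uniq_comps k n : uniq (comps k n).
Proof.
elim: k n => [|k IHk] n; first by case: n.
apply: (@allpairs_uniq_dep _ _ _ (fun a t => a :: t)); rewrite ?iota_uniq //.
by move=> [a t] [b u] /= _ _ [-> ->].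
Qed.

Lemma inset_toggle m b s : inset (toggle m s) b = (m == b) (+) inset s b.
Proof.
rewrite /toggle /inset; case E: (PM.find (mkey m) s) => [r|].
  case: eqP => [<-|ne]; first by rewrite PM.grs E.
  by rewrite PM.gro // => /mkey_inj bm; case: ne.
case: eqP => [<-|ne]; first by rewrite PM.gss E.
by rewrite PM.gso // => /mkey_inj bm; case: ne.
Qed.

Lemma rsum_delta_toggle b r : rsum (delta b) r = (inset (foldr toggle (PM.empty _) r) b)%:R.
Proof.
elim: r => [|m r IHr] /=; first by rewrite rsum_nil /inset PM.gempty.
rewrite rsum_cons IHr inset_toggle /delta.
by case: (m == b); case: (inset _ _); rewrite ?addr0 ?add0r // F2_addxx.
Qed.

Lemma rsum_filter_uniq (D : terms) (P : pred (seq nat)) b : uniq D -> b \in D ->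
  rsum (delta b) [seq d <- D | P d] = (P b)%:R.
Proof. by move=> uD bD; rewrite rsum_delta ?filter_uniq // mem_filter bD andbT. Qed.

Lemma terms_eq_rsum c r1 r2 : terms_eq r1 r2 -> rsum c r1 = rsum c r2.
Proof.
rewrite /terms_eq => /nilP E; apply/eqP.
by rewrite -[rsum c r2]F2_oppr -addr_eq0 -rsum_xmerge E rsum_nil.
Qed.

(** * Soundness of the tables in degree 38 *)

Local Notation dual := 'Hom(dhomog 4 'F_2 n3, ('F_2)^o).
Local Notation coef := (@coefz 4 n3).
Local Notation A38 := (Ann 4 n3).

Section AnnCoef.
Variable z : dual.
Hypothesis zA : z \in A38.

Let V r := rsum (coef z) r = 0.

Lemma rsum0_xmerge r1 r2 : V r1 -> V r2 -> V (xmerge r1 r2).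
Proof. by rewrite /V rsum_xmerge => -> ->; rewrite addr0. Qed.

Lemma add_hits_ok fuel k n ms t : (0 < k)%N -> (n <= 38)%N ->
  {subset ms <= comps 4 n} -> tab_ok V t -> tab_ok V (add_hits fuel k ms t).
Proof.
move=> k0 len; rewrite /add_hits; elim: ms t => [|m ms IHms] t //= sub_ms tP.
have := sub_ms m; rewrite inE eqxx mem_comps => /(_ isT)/andP[/eqP szm /eqP summ].
apply: IHms => [x xms|]; first by apply: sub_ms; rewrite inE xms orbT.
apply: tab_ok_add_row => //; first exact: rsum0_xmerge.
rewrite sq_terms39E; first exact: (Ann_coefz zA).
by apply: all_lt_sumn; rewrite summ ltnS.
Qed.

Lemma hits_ok : tab_ok V hits.
Proof.
rewrite /hits.
apply: (@add_hits_ok _ _ 30) => //; first exact: mem_mask_bits.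
apply: (@add_hits_ok _ _ 34) => //; first exact: mem_mask_bits.
apply: (@add_hits_ok _ _ 36) => //.
apply: (@add_hits_ok _ _ 37) => //.
exact: tab_ok_empty.
Qed.

Lemma nf38_ok : nf_ok (coef z) nf38.
Proof. exact: (nf_table_ok hits_ok). Qed.

End AnnCoef.

Definition gen (g : nat * nat) : {'GL_4['F_2]} := @transvection 4 (inord g.1) (inord g.2).

Lemma mem_offdiag g : g \in offdiag -> [/\ g.1 < 4, g.2 < 4 & g.1 != g.2]%N.
Proof.
rewrite mem_filter -[eqn _ _]/(g.1 == g.2) => /andP[-> /allpairsP[[i j] []]].
by rewrite !mem_iota => /andP[_ i4] /andP[_ j4] ->.
Qed.

Lemma coefz_gen (z : dual) g m : g \in offdiag -> m \in comps 4 38 ->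
  coef (dual_act (gen g) z) m = rsum (coef z) (transv odd_bins39 g.1 g.2 m).
Proof.
case/mem_offdiag=> g1 g2 ne; rewrite mem_comps => /andP[/eqP szm /eqP summ].
rewrite /gen coefz_dual_act // ?inordK // ?transv39E //.
  by apply: all_lt_sumn; rewrite summ.
by apply: contra ne => /eqP/(congr1 val); rewrite /= !inordK // => ->.
Qed.

(** * From unit vectors in the span to all of Ann *)

Section Span.
Variable S : dual -> Prop.
Hypothesis S0 : S 0.
Hypothesis SD : forall z z', z \in A38 -> z' \in A38 -> S z -> S z' -> S (z + z').
Hypothesis S_act : forall g z, z \in A38 -> S z -> S (dual_act g z).
Variables (nt : table) (D : terms).
Hypothesis nt_ok : forall z : dual, z \in A38 -> nf_ok (coef z) nt.
Hypothesis uniqD : uniq D.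
Hypothesis subD : {subset D <= comps 4 38}.

(** Only the parity of the multiplicity of d in v counts. The values of z outside [D] are left free
    here; for z in Ann the normal forms determine them. *)
Definition good (v : terms) := exists z : dual,
  [/\ z \in A38, S z & forall d, d \in D -> coef z d = rsum (delta d) v].

Lemma goodD v w u : good v -> good w ->
  (forall d, rsum (delta d) u = rsum (delta d) v + rsum (delta d) w) -> good u.
Proof.
move=> [z [zA zS zv]] [y [yA yS yw]] uE; exists (z + y); split.
- exact: rpredD.
- exact: SD.
by move=> d dD; rewrite coefzD (zv d dD) (yw d dD) uE.
Qed.

Lemma good_nil : good [::].
Proof.
exists 0; split; [exact: mem0v | exact: S0 | move=> d _].
by rewrite coefz0 rsum_nil.
Qed.

Lemma good_xmerge v w : good v -> good w -> good (xmerge v w).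
Proof. by move=> gv gw; apply: (goodD gv gw) => d; rewrite rsum_xmerge. Qed.

Lemma good_cat v w : good v -> good w -> good (v ++ w).
Proof. by move=> gv gw; apply: (goodD gv gw) => d; rewrite rsum_cat. Qed.

Definition good_mx (M : seq (seq nat * terms)) := exists g, [/\ g \in offdiag,
  M = transv_mx nt D g &
  all (fun p => all (inset (toset D)) p.2) M].

(** If z realises v, then gz realises [act M v]. The rows of M have to stay inside [D], because only
    there is z known through v. *)
Lemma good_act M v : good_mx M -> good v -> good (act M v).
Proof.
move=> [g [gP ME /allP Msub]] [z [zA zS zv]]; exists (dual_act (gen g) z).
split; [exact: Ann_stable | exact: S_act |] => d dD.
rewrite coefz_gen ?subD // -(rsum_nf_sum _ (nt_ok zA)) /act.
set s := foldr toggle _ _; pose f r := foldr (fun b o => inset s b (+) o) false r.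
have -> : [seq p.1 | p <- M & f p.2] =
    [seq d <- D | f (nf_sum nt (transv odd_bins39 g.1 g.2 d))].
  rewrite ME /transv_mx filter_map -map_comp map_id_in //.
rewrite rsum_filter_uniq ?uniqD //.
set r := nf_sum _ _.
have rD : {subset r <= D}.
  move=> b br; rewrite -in_inset.
  have /Msub/allP/(_ b br) // : (d, r) \in M by rewrite ME; apply/mapP; exists d.
elim: r rD => [|b r IHr] rD /=; first by rewrite rsum_nil.
rewrite rsum_cons IHr => [|c cr]; last by apply: rD; rewrite inE cr orbT.
rewrite zv ?rD ?inE ?eqxx // rsum_delta_toggle -/s.
by case: (inset s b); case: (f r); rewrite ?addr0 ?add0r // F2_addxx.
Qed.

Lemma orbit_table_ok p Ms st t : (forall M, M \in Ms -> good_mx M) ->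
  (forall v M, (v, M) \in st -> good v /\ good_mx M) ->
  tab_ok good t -> tab_ok good (orbit_table p Ms st t).
Proof.
move=> MsP; elim: p st t => [p IHp|p IHp|] [|[v M] st] t stP tP; try exact: tP.
  have [gv gM] := stP v M (mem_head _ _).
  have gw : good (xmerge (act M v) v) by exact: good_xmerge (good_act gM gv) gv.
  apply: IHp => [w M'|]; last by exact: (tab_ok_add_row good_xmerge tP gw).
  rewrite mem_cat => /orP[/mapP[M'' M''s [-> ->]]|wM]; first by split; [exact: gw | exact: MsP].
  by apply: stP; rewrite inE wM orbT.
apply: IHp tP => w M' wM; apply: stP; rewrite inE wM orbT; exact: isT.
Qed.

Lemma spans_unitsP t ds pre : tab_ok good t -> spans_units t ds (toset pre) ->
  (forall d, d \in pre -> good [:: d]) -> forall d, d \in ds -> good [:: d].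
Proof.
move=> tP; elim: ds pre => [|d ds IHds] pre //=.
case E: (PM.find _ _) => [[|p q]|] // /andP[/allP qpre ok] preP.
have [gpq /mkey_inj /= dp] := tP _ _ E.
have gq : good q.
  elim: q qpre {E gpq} => [|b q IHq] qpre; first exact: good_nil.
  rewrite -cat1s; apply: good_cat.
    by apply: preP; rewrite -in_inset; apply: qpre; rewrite inE eqxx.
  by apply: IHq => c cq; apply: qpre; rewrite inE cq orbT.
have gd : good [:: d].
  apply: (goodD gpq gq) => e; rewrite -dp !rsum_cons rsum_nil.
  by rewrite -addrA F2_addxx.
have pre'P e : e \in d :: pre -> good [:: e].
  by rewrite inE => /orP[/eqP->|/preP].
by move=> e; rewrite inE => /orP[/eqP->//|]; exact: (IHds (d :: pre)).
Qed.

(** A sum of unit vectors yields some y in Ann with S y that agrees with z on [D]. All normal forms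
    lie in [D], so y and z agree on every monomial and are equal. *)
Lemma good_all (z : dual) : (forall m, m \in comps 4 38 ->
    all (inset (toset D)) (nf nt m)) ->
  (forall d, d \in D -> good [:: d]) -> z \in A38 -> S z.
Proof.
move=> nfD units zA.
have [y [yA yS yE]] : good [seq d <- D | coef z d == 1].
  have : {subset [seq d <- D | coef z d == 1] <= D}.
    by move=> d; rewrite mem_filter => /andP[].
  elim: [seq d <- _ | _] => [|d r IHr] rD; first exact: good_nil.
  rewrite -cat1s; apply: good_cat; first by apply/units/rD/mem_head.
  by apply: IHr => e er; apply: rD; rewrite inE er orbT.
have -> : z = y; last exact: yS.
apply: (@coefz_inj 4 n3) => m szm summ.
have mP : m \in comps 4 38 by rewrite mem_comps szm summ.
rewrite -(rsum_nf _ (nt_ok zA)) -(rsum_nf m (nt_ok yA)).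
rewrite /rsum big_seq [RHS]big_seq; apply: eq_bigr => b bm.
have bD : b \in D by rewrite -in_inset; exact: (allP (nfD m mP)).
rewrite yE // rsum_filter_uniq ?uniqD //.
by case: (F2_cases (coef z b)) => ->.
Qed.

End Span.

Lemma uniq_filter_rev (s D : terms) P : D = filter P (rev s) -> uniq s -> uniq D.
Proof. by move=> -> us; rewrite filter_uniq // rev_uniq. Qed.

Lemma sub_filter_rev (s D : terms) P : D = filter P (rev s) -> {subset D <= s}.
Proof. by move=> -> d; rewrite mem_filter mem_rev => /andP[]. Qed.

Lemma basis38E : basis38 = filter (fun m => ~~ inset hits m) (rev (comps 4 38)).
Proof. by rewrite /basis38 /degree38. Qed.

Lemma uniq_basis38 : uniq basis38.
Proof. exact: (uniq_filter_rev basis38E (uniq_comps 4 38)). Qed.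

Lemma sub_basis38 : {subset basis38 <= comps 4 38}.
Proof. exact: (sub_filter_rev basis38E). Qed.

(** * Sums of divided power monomials: membership in Ann and pairings *)

Definition divpow_sum (L : terms) : dual := \sum_(a <- L) divpow 4 n3 a.

Lemma deltaC a b : delta a b = delta b a.
Proof. by rewrite /delta eq_sym. Qed.

Lemma coefz_divpow_sum L t : {subset L <= comps 4 38} -> size t = 4%N ->
  coef (divpow_sum L) t = rsum (delta t) L.
Proof.
move=> subL szt; rewrite coefz_sum /rsum big_seq [RHS]big_seq.
apply: eq_bigr => a /subL; rewrite mem_comps => /andP[/eqP sza /eqP suma].
by rewrite coefz_divpow // deltaC.
Qed.

Lemma divpow_sum_Ann L : {subset L <= comps 4 38} -> annihilated_terms L ->
  divpow_sum L \in A38.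
Proof.
move=> subL annL; apply: (@coefz_Ann 4 n3) => k m k0 szm summ.
have lt_m : (sumn m < 38)%N by rewrite -[38%N]n3E -summ -addn1 leq_add2l.
rewrite /rsum sum_sq_terms.
(* The functional vanishes outside degree 38, so Sq^k may be replaced by the total square. By
   adjunction the sum is the coefficient of m in the dual total square of L, that is in L itself,
   and m has degree below 38. *)
transitivity (\sum_(t <- sq_total_terms m) rsum (delta t) L).
  rewrite big_mkcond big_seq [RHS]big_seq; apply: eq_bigr => t /mem_sq_total_terms[szt _].
  rewrite -coefz_divpow_sum ?szt // summ; case: eqP => // /eqP ne.
  by rewrite (@coefz_deg 4 n3) ?szt.
rewrite /rsum exchange_big /=.
transitivity (rsum (delta m) (msum [seq sq_dual_terms a | a <- L])).
  rewrite rsum_msum big_map big_seq [RHS]big_seq; apply: eq_bigr => a /subL.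
  rewrite mem_comps => /andP[/eqP sza _]; rewrite -sum_sq_dual_terms ?szm //.
  by apply: eq_bigr => t _; exact: deltaC.
rewrite (terms_eq_rsum _ annL) rsum_msum big_map big_seq big1 // => a /subL.
rewrite mem_comps => /andP[_ /eqP suma]; rewrite rsum_seq1 /delta.
by case: eqP => // am; rewrite -am suma ltnn in lt_m.
Qed.

Definition pairing (p : terms) (z : dual) : 'F_2 := rsum (coef z) p.

Lemma pairing_divpow_sum p L : {subset L <= comps 4 38} -> {subset p <= comps 4 38} ->
  pairing p (divpow_sum L) = (odd (sumn [seq count_mem m L | m <- p]))%:R.
Proof.
move=> subL subp; rewrite -modn2 (GRing.natr_mod_pchar (pchar_Fp (isT : prime 2))).
rewrite sumnE big_map natr_sum /pairing /rsum [LHS]big_seq [RHS]big_seq.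
apply: eq_bigr => m /subp; rewrite mem_comps => /andP[/eqP szm _].
rewrite coefz_divpow_sum // /rsum -sum1_count natr_sum [RHS]big_mkcond /=.
by apply: eq_bigr => b _; rewrite /delta; case: eqP.
Qed.

Lemma pairingD p z z' : pairing p (z + z') = pairing p z + pairing p z'.
Proof.
by rewrite /pairing /rsum -big_split; apply: eq_bigr => m _; exact: coefzD.
Qed.

Lemma offdiag_ord (i j : 'I_4) : i != j -> (nat_of_ord i, nat_of_ord j) \in offdiag.
Proof.
move=> ne; rewrite mem_filter -[eqn _ _]/(i == j) ne andTb.
by apply/allpairsP; exists (nat_of_ord i, nat_of_ord j); rewrite !mem_iota !ltn_ord.
Qed.

(** * Invariant pairings and their descent to coinvariants *)

Section Invariants.
Variable nt : table.
Hypothesis nt_ok : forall z : dual, z \in A38 -> nf_ok (coef z) nt.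

Lemma pairing_invariant p (g : {'GL_4['F_2]}) z : {subset p <= comps 4 38} ->
  invariant_terms nt p -> z \in A38 -> pairing p (dual_act g z) = pairing p z.
Proof.
move=> subp /allP inv; move: g z.
have inv_transvection (i j : 'I_4) z : i != j -> z \in A38 ->
    pairing p (dual_act (@transvection 4 i j) z) = pairing p z.
  move=> ne zA; have ijP := offdiag_ord ne.
  rewrite /pairing -(rsum_nf_sum p (nt_ok zA)) -(terms_eq_rsum _ (inv _ ijP)).
  rewrite (rsum_nf_sum _ (nt_ok zA)) rsum_flatten big_map /rsum.
  rewrite big_seq [RHS]big_seq; apply: eq_bigr => m /subp mP.
  by have := coefz_gen z ijP mP; rewrite /gen !inord_val; exact.
apply: (@GL2_ind 4) => [z zA|g i j ne IH z zA]; first by rewrite dual_act1.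
(* With t the transvection, gz = (g t)(t z): the induction hypothesis removes g t, and invariance
   under t removes the remaining factor. *)
have tz : dual_act (@transvection 4 i j) (dual_act (@transvection 4 i j) z) = z.
  by rewrite -dual_actM -[X in dual_act (X * _)%g _](transvectionV ne) mulVg dual_act1.
rewrite -[in LHS]tz -dual_actM IH ?inv_transvection //.
exact: Ann_stable.
Qed.

End Invariants.

Lemma coinv_class_act (g : {'GL_4['F_2]}) (z : dual) (zA : z \in A38)
    (gzA : dual_act g z \in A38) : coinv_class gzA = coinv_class zA.
Proof.
apply/quot_piP.
have -> : Subvs gzA - Subvs zA = (linfun (@Ann_act 4 n3 g) - \1%VF)%VF (Subvs zA).
  by rewrite add_lfunE opp_lfunE id_lfunE lfunE; apply: val_inj.
by apply: (subvP (sumv_sup g isT (subvv _))); exact: memv_img (memvf _).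
Qed.

(** The relations are sums of elements gz - z, and an invariant pairing kills each of them. *)
Lemma pairing_coinv_rel p u :
  (forall g z, z \in A38 -> pairing p (dual_act g z) = pairing p z) ->
  u \in coinv_rel 4 n3 -> pairing p (vsval u) = 0.
Proof.
move=> inv; case/memv_sumP=> w wP ->; rewrite raddf_sum /=.
elim/big_rec: _ => [|g y _ IH].
  by rewrite /pairing /rsum big1 // => m _; exact: coefz0.
rewrite pairingD IH addr0; case/memv_imgP: (wP g isT) => v _ ->.
rewrite add_lfunE opp_lfunE id_lfunE lfunE /=.
have := inv g _ (subvsP v); set a := dual_act _ _; set b := vsval v => E.
apply: (addIr (pairing p b)); rewrite -pairingD subrK add0r.
exact: E.
Qed.

Lemma coinv_class_eq0 p (z : dual) (zA : z \in A38) :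
  (forall g y, y \in A38 -> pairing p (dual_act g y) = pairing p y) ->
  coinv_class zA = 0 -> pairing p z = 0.
Proof.
move=> inv /esym/quot_piP; rewrite sub0r memvN => /(pairing_coinv_rel inv).
by [].
Qed.

Lemma coinv_class_eq p (z y : dual) (zA : z \in A38) (yA : y \in A38) :
  (forall g u, u \in A38 -> pairing p (dual_act g u) = pairing p u) ->
  coinv_class zA = coinv_class yA -> pairing p z = pairing p y.
Proof.
move=> inv /quot_piP/(pairing_coinv_rel inv) /= E.
by rewrite -(subrK y z) pairingD E add0r.
Qed.

Lemma coinv_class0 (z0 : (0 : dual) \in A38) : coinv_class z0 = 0.
Proof.
rewrite /coinv_class; have -> : Subvs z0 = 0 by apply: val_inj.
exact: (linear0 (quot_pi (coinv_rel 4 n3))).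
Qed.

Lemma coinv_classD (z y : dual) (zA : z \in A38) (yA : y \in A38) (zyA : z + y \in A38) :
  coinv_class zyA = coinv_class zA + coinv_class yA.
Proof.
rewrite /coinv_class; have -> : Subvs zyA = Subvs zA + Subvs yA by apply: val_inj.
exact: (linearD (quot_pi (coinv_rel 4 n3))).
Qed.

Lemma coinv_class_vsval (u : subvs_of A38) (uA : vsval u \in A38) :
  coinv_class uA = quot_pi (coinv_rel 4 n3) u.
Proof. by rewrite /coinv_class; congr quot_pi; apply: val_inj. Qed.

Lemma subset_comps (L : terms) :
  all (fun m => (size m == 4%N) && (sumn m == 38%N)) L -> {subset L <= comps 4 38}.
Proof. by move/allP=> LP m /LP; rewrite mem_comps. Qed.

Lemma x_exponents_comps : {subset x_exponents <= comps 4 38}.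
Proof. by apply: subset_comps; vm_compute. Qed.

Lemma zeta_exponents_comps : {subset zeta_tilde_exponents <= comps 4 38}.
Proof. by apply: subset_comps; vm_compute. Qed.

Lemma x_detector_comps : {subset x_detector <= comps 4 38}.
Proof. by apply: subset_comps; vm_compute. Qed.

Lemma zeta_detector_comps : {subset zeta_detector <= comps 4 38}.
Proof. by apply: subset_comps; vm_compute. Qed.

Lemma orbit_gens_offdiag : {subset orbit_gens <= offdiag}.
Proof. by apply/allP; vm_compute. Qed.

(** * The basis of the coinvariants *)

Section Coinvariants.
Variables (nt : table) (D : terms).
Hypothesis nt_ok : forall z : dual, z \in A38 -> nf_ok (coef z) nt.
Hypothesis uniqD : uniq D.
Hypothesis subD : {subset D <= comps 4 38}.
Hypothesis cert : certificate nt D.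

Let x := divpow_sum x_exponents.
Let y := divpow_sum zeta_tilde_exponents.

Lemma x_Ann : x \in A38.
Proof.
have /and5P[ax _ _ _ _] := cert; exact: divpow_sum_Ann x_exponents_comps ax.
Qed.

Lemma zeta_Ann : y \in A38.
Proof.
have /and5P[_ az _ _ _] := cert; exact: divpow_sum_Ann zeta_exponents_comps az.
Qed.

Let X := coinv_class x_Ann.
Let Y := coinv_class zeta_Ann.

(** [coinv_class] takes a proof of membership; hiding it makes this a predicate on functionals, fit
    for the role of [S] above. *)
Definition spanned (z : dual) :=
  exists zA : z \in A38, coinv_class zA \in <<[:: X; Y]>>%VS.

Lemma spanned_Ann z : z \in A38 -> spanned z.
Proof.
have S0 : spanned 0 by exists (mem0v A38); rewrite coinv_class0; exact: mem0v.
have SD z1 z2 : z1 \in A38 -> z2 \in A38 -> spanned z1 -> spanned z2 -> spanned (z1 + z2).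
  move=> _ _ [A1 S1] [A2 S2]; exists (memvD A1 A2).
  by rewrite (coinv_classD A1 A2); exact: memvD.
have S_act g z1 : z1 \in A38 -> spanned z1 -> spanned (dual_act g z1).
  by move=> _ [A1 S1]; exists (Ann_stable g A1); rewrite (coinv_class_act A1).
(* [coords] lists each monomial of [L] once, so it is the coordinate vector only if [L] has no
   repetitions. *)
have good_coords L (zA : divpow_sum L \in A38) : {subset L <= comps 4 38} -> uniq L ->
    coinv_class zA \in <<[:: X; Y]>>%VS -> good spanned D (coords D L).
  move=> subL uL LS; exists (divpow_sum L); split; [exact: zA | by exists zA | move=> d dD].
  have szd : size d = 4%N by have := subD dD; rewrite mem_comps => /andP[/eqP].
  rewrite (coefz_divpow_sum subL szd) (rsum_filter_uniq _ uniqD dD) in_inset.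
  exact: rsum_delta.
have gx : good spanned D (coords D x_exponents).
  apply: (good_coords _ x_Ann x_exponents_comps isT); apply: memv_span; exact: mem_head.
have gy : good spanned D (coords D zeta_tilde_exponents).
  apply: (good_coords _ zeta_Ann zeta_exponents_comps); first by vm_compute.
  apply: memv_span; exact: (mem_last X [:: Y]).
have /and5P[_ _ /allP nfD _ /and3P[_ /allP MD units]] := cert.
have MP M : M \in [seq transv_mx nt D g | g <- orbit_gens] -> good_mx nt D M.
  move=> MM; have MDM := MD M MM; case/mapP: MM => g gP ME; exists g.
  by split; [exact: orbit_gens_offdiag | exact: ME | exact: MDM].
apply: (@good_all spanned S0 SD nt D nt_ok uniqD z nfD) => d; rewrite -mem_rev.
have gm := good_xmerge SD.
apply: (@spans_unitsP _ S0 SD _ _ _ [::] _ units) => [|e]; last by rewrite in_nil.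
apply: (orbit_table_ok SD S_act nt_ok uniqD subD MP).
  move=> v M; rewrite mem_cat => /orP[] /mapP[M' /MP gM' [-> ->]].
    by split; [exact: gy | exact: gM'].
  by split; [exact: gx | exact: gM'].
apply: (tab_ok_add_row (gm D)) gy; apply: (tab_ok_add_row (gm D)) gx.
exact: tab_ok_empty.
Qed.

Lemma basis_coinv : basis_of {: coinv 4 n3} [:: X; Y].
Proof.
have /and5P[_ _ _ ix /and3P[iy _ _]] := cert.
have inv p (subp : {subset p <= comps 4 38}) (ip : invariant_terms nt p) g z :
    z \in A38 -> pairing p (dual_act g z) = pairing p z.
  exact: (pairing_invariant nt_ok).
rewrite /basis_of; apply/andP; split.
  rewrite eqEsubv subvf; apply/subvP => v _.
  rewrite -(quot_piK v); move: (generic_quotient.repr v) => u.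
  have [zA] := spanned_Ann (subvsP u).
  by rewrite coinv_class_vsval.
rewrite free_cons seq1_free span_seq1; apply/andP; split.
  (* [x_detector] takes the value 1 on x and 0 on zeta, so X is no multiple of Y. *)
  apply/negP => /vlineP[k XY]; have invx := inv _ x_detector_comps ix.
  have : pairing x_detector x = 0.
    case: (F2_cases k) XY => ->; first by rewrite scale0r => /(coinv_class_eq0 invx).
    rewrite scale1r => /(coinv_class_eq invx)->.
    rewrite pairing_divpow_sum; [|exact: zeta_exponents_comps|exact: x_detector_comps].
    (* The exponents of zeta are all at least 3, and [x_detector] shares no monomial with it. *)
    by vm_compute.
  rewrite pairing_divpow_sum; [|exact: x_exponents_comps|exact: x_detector_comps].
  by vm_compute.
apply/eqP => Y0.
have := coinv_class_eq0 (inv _ zeta_detector_comps iy) Y0.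
rewrite pairing_divpow_sum; [|exact: zeta_exponents_comps|exact: zeta_detector_comps].
(* The only common monomial has exponents (7, 7, 7, 17), so the pairing is 1. *)
by vm_compute.
Qed.

End Coinvariants.

Lemma divpow_x_exponents : divpow 4 n3 [:: 0; 0; 7; 31]%N = divpow_sum x_exponents.
Proof. by rewrite /divpow_sum big_seq1. Qed.

Theorem theorem2p1p6 :
  exists (xA : divpow 4 n3 [:: 0; 0; 7; 31]%N \in Ann 4 n3)
         (zA : zeta_tilde \in Ann 4 n3),
    \dim {: coinv 4 n3} = 2%N /\
    basis_of {: coinv 4 n3} [:: coinv_class xA; coinv_class zA].
Proof.
rewrite divpow_x_exponents.
have B := basis_coinv nf38_ok uniq_basis38 sub_basis38 certificate_ok.
(* [zeta_tilde] is convertible to [divpow_sum zeta_tilde_exponents], so no rewriting is required for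
   it. *)
exists (x_Ann certificate_ok), (zeta_Ann certificate_ok).
split; last exact: B.
by have /andP[/eqP <- /eqnP] := B.
Qed.
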